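(* Let $q\ge 2$ be an integer, let $\mathcal{T}$ be the homogeneous tree of degree $q+1$ with base point $o$, let $h_t$ be the heat kernel on $\mathcal{T}$ and $h_t^{\mathbb{Z}}$ the heat kernel on $\mathbb{Z}$, and put $\gamma(0)=2\sqrt q/(q+1)$. (1) For $x\in\mathcal{T}$ such that $|x|\to\infty$ and $t\to\infty$, $$h_t(x)\sim c\,\frac{2}{\gamma(0)}\,t^{-1}e^{-(1-\gamma(0))t}\,(1+|x|)\,q^{-|x|/2}\,h^{\mathbb{Z}}_{t\gamma(0)}(|x|+1),$$ where $c=1+C$ is an explicit constant depending on the limit of $|x|/t$: $$C=\begin{cases}\displaystyle\sum_{k=1}^{\infty}q^{-k}\Big(\frac{s_0}{1+\sqrt{1+s_0^2}}\Big)^{2k}, & \text{if } |x|/t\to C_0>0,\ \text{where } s_0=\gamma(0)/C_0,\\[2mm] \dfrac{1}{q-1}, & \text{if } |x|/t\to 0,\\[2mm] 0, & \text{if } |x|/t\to\infty.\end{cases}$$ (2) If instead $x\in\mathcal{T}$ is such that $|x|\le\rho(t)$, with $\rho(t)/\sqrt t\to 0$ as $t\to\infty$, then $$h_t(x)=\frac{\sqrt2}{\sqrt\pi}\,\frac{q(q+1)}{(q-1)^2}\,\gamma(0)^{-3/2}\,t^{-3/2}\,e^{-(1-\gamma(0))t}\,\varphi_0(x)\Big(1+O\Big(\frac{\rho(t)}{\sqrt t}\Big)\Big),$$ where $\varphi_0(x)=\big(1+\frac{q-1}{q+1}|x|\big)q^{-|x|/2}$.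
   Context: The homogeneous tree $\mathcal{T}$ of degree $q+1$ is the infinite connected graph without loops (cycles) in which every vertex has exactly $q+1$ neighbours; it is identified with its vertex set. $d(x,y)$ is the graph distance, $o\in\mathcal{T}$ is a fixed base point and $|x|=d(x,o)$. The Laplacian is $\mathcal{L}f(x)=f(x)-\frac1{q+1}\sum_{y:\,d(x,y)=1}f(y)$, a bounded operator on $\ell^p(\mathcal{T})$ (counting measure). The heat kernel is $h_t(x,y)=(e^{-t\mathcal{L}}\delta_y)(x)$, which depends only on $t$ and $d(x,y)$; one writes $h_t(x)=h_t(x,o)$. The heat kernel on the integers is the one associated with $\mathcal{L}^{\mathbb{Z}}f(j)=f(j)-\frac{f(j+1)+f(j-1)}2$, namely $h_t^{\mathbb{Z}}(j)=e^{-t}I_{|j|}(t)$ with $I_\nu$ the modified Bessel function of the first kind. The notation $a\sim b$ means $a/b\to1$.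
   Formalization: Part (2) additionally assumes ρ(t) ≥ c/√t for some c > 0 and all large t; without it the claim fails, e.g. for ρ = 0 and x = o, where it would force an exact equality although the true relative error is of order 1/t. *)

(* Defs.v *)
From HB Require Import structures.
From mathcomp Require Import all_boot all_order all_algebra.
From mathcomp Require Import all_classical all_reals all_analysis.
Set Implicit Arguments.
Unset Strict Implicit.
Unset Printing Implicit Defensive.
Import Order.TTheory GRing.Theory Num.Theory.
Import numFieldNormedType.Exports.
Local Open Scope classical_set_scope.
Local Open Scope ring_scope.

Definition connected_by (T : choiceType) (adj : rel T) (x y : T) (n : nat)
    : bool :=
  `[< exists p : seq T, [/\ path adj x p, last x p = y & size p = n] >].

(* The value 0 for disconnected x and y is junk. *)
Definition gdist (T : choiceType) (adj : rel T) (x y : T) : nat :=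
  if pselect (exists n, connected_by adj x y n) is left h then ex_minn h
  else 0%N.

(* In a simple graph a cycle has at least three vertices: [:: x] is a path
   cycle only if adj x x, and [:: x; y] runs back and forth along an edge. *)
Record homogeneous_tree (q : nat) (T : choiceType) (adj : rel T) : Prop :=
  HomogeneousTree {
    htree_sym : symmetric adj;
    htree_irr : irreflexive adj;
    htree_infinite : infinite_set [set: T];
    htree_connected : forall x y : T, exists n, connected_by adj x y n;
    htree_acyclic : forall c : seq T, uniq c -> cycle adj c -> (size c <= 2)%N;
    htree_degree : forall x : T, ([set y | adj x y] #= `I_q.+1)%card }.

(* e^{-tL} delta_y evaluated at x.  For a bounded operator L on l^p the
   exponential series converges in operator norm; its value at delta_y and x
   is therefore the sum of the scalar series of (-t)^n / n! (L^n delta_y)(x). *)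
Definition heat_kernel (R : realType) (V : eqType)
    (L : (V -> R) -> V -> R) (t : R) (x y : V) : R :=
  limn (series (fun n : nat =>
    (- t) ^+ n / n`!%:R * iter n L (fun z => (z == y)%:R) x)).

Definition tree_laplacian (R : realType) (q : nat) (T : choiceType)
    (adj : rel T) (f : T -> R) (x : T) : R :=
  f x - (q.+1%:R)^-1 * \sum_(y \in [set y | gdist adj x y = 1%N]) f y.

Definition int_laplacian (R : realType) (f : int -> R) (j : int) : R :=
  f j - (f (j + 1) + f (j - 1)) / 2.

Definition tree_heat (R : realType) (q : nat) (T : choiceType) (adj : rel T)
    (o : T) (t : R) (x : T) : R :=
  heat_kernel (tree_laplacian q adj) t x o.

Definition int_heat (R : realType) (t : R) (j : int) : R :=
  heat_kernel (@int_laplacian R) t j 0.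

Definition gamma0 (R : realType) (q : nat) : R :=
  2 * Num.sqrt q%:R / q.+1%:R.

(* The spherical function phi_0 at a vertex at distance n from the base point. *)
Definition phi0 (R : realType) (q n : nat) : R :=
  (1 + (q%:R - 1) / q.+1%:R * n%:R) * q%:R `^ (- (n%:R / 2)).

(* Main.v *)
Require Import Defs.
From mathcomp Require Import all_boot all_order all_algebra.
From mathcomp Require Import all_classical all_reals all_analysis.
From mathcomp Require Import ring lra zify.
Import Order.TTheory GRing.Theory Num.Theory.
Import numFieldNormedType.Exports.
Local Open Scope classical_set_scope.
Local Open Scope ring_scope.

(* The radial part of the simple random walk on the tree, conjugated by
   [sqrt q ^ |x|], is the simple random walk on the half line with a modified
   reflection at the origin; comparing the two reflections gives, with
   [I_n] the modified Bessel functions, [s = gamma(0) t] and [n = |x|],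
     h_t(x) = e^-t q^(-n/2) (2/s) \sum_(k >= 0) q^-k (n+2k+1) I_(n+2k+1)(s).
   Part (1) follows by dominated convergence from the ratio bounds
   rho_(n+1) <= I_(n+1)(s) / I_n(s) <= rho_n, rho_n = (sqrt (n^2 + s^2) - n) / s,
   which come from the three-term recurrence by descending induction on [n].
   For part (2), the same bounds give I_n(s) = I_0(s) (1 + O(n^2/s)); moreover
   e^-s I_0(s) is the average of the return probabilities of the simple random
   walk over a Poisson number of steps, so sqrt (2 pi s) e^-s I_0(s) = 1 + O(1/s)
   results from Wallis' inequalities and a few moments of the Poisson law. *)

(** * Exponential generating functions *)

(** The two walks differ only at the origin. At every time, u(n) - u(n+2)/q for the tree walk equals
    u(n) - u(n+2) for the simple walk: the two expressions agree at time 0 and obey the same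
    recursion, at the origin too. Together with s (I_n - I_(n+2)) = 2 (n+1) I_(n+1) this makes
    [tree_gf] a solution of u(n) - u(n+2)/q = (2/s) (n+1) I_(n+1)(s), and the sum over k is what
    iterating this equation produces. The obstacle is uniformity: n and s vary together, so an
    expansion at fixed n is of no use, and bounds explicit in both are kept throughout. The infinite
    sum is never formed. Either the equation is iterated K times with an exact remainder, or
    solutions are compared through the principle that a sequence of at most linear growth with y(n)
    <= y(n+2)/q is nonpositive. Identities between Bessel functions are reduced to identities
    between the coefficients of their exponential series, that is between walk weights, where
    induction on the number of steps proves them. *)

Section ExponentialSeries.
Set Implicit Arguments.
Unset Strict Implicit.
Variable R : realType.
Implicit Types (c d : nat -> R) (s t : R).

(** Base 2 suffices: the coefficients met below are bounded or grow like m, and the series is then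
    dominated by the exponential series at twice the modulus of [s]. *)
Definition geom_bounded c := exists K : R, forall m, `|c m| <= K * 2 ^+ m.

Definition egf c s : R := limn (series (fun m => s ^+ m / m`!%:R * c m)).

Lemma geom_bounded1 c (K : R) : (forall m, `|c m| <= K) -> geom_bounded c.
Proof.
move=> cK; exists K => m; apply: le_trans (cK m) _.
by rewrite ler_peMr ?exprn_ege1 ?ler1n//; exact: le_trans (cK 0%N).
Qed.

Lemma geom_boundedD c d :
  geom_bounded c -> geom_bounded d -> geom_bounded (fun m => c m + d m).
Proof.
move=> [K cK] [L dL]; exists (K + L) => m.
by apply: le_trans (ler_normD _ _) _; rewrite mulrDl lerD.
Qed.

Lemma geom_boundedZ c (a : R) :
  geom_bounded c -> geom_bounded (fun m => a * c m).
Proof.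
move=> [K cK]; exists (`|a| * K) => m.
by rewrite normrM -mulrA ler_wpM2l.
Qed.

Lemma geom_bounded_comp c (a : R) :
  geom_bounded c -> `|a| <= 1 -> geom_bounded (fun m => a ^+ m * c m).
Proof.
move=> [K cK] a1; exists K => m; rewrite normrM normrX.
by apply: le_trans (cK m); rewrite ler_piMl// exprn_ile1.
Qed.

Lemma geom_bounded_nat : geom_bounded (fun m => m%:R).
Proof.
exists 1 => m; rewrite mul1r ger0_norm// -natrX ler_nat.
exact: ltnW (ltn_expl _ _).
Qed.

Lemma geom_bounded_shift c :
  geom_bounded c -> geom_bounded (fun m => c m.+1 / m.+1%:R).
Proof.
move=> [K cK]; exists (K * 2) => m; rewrite -mulrA -exprS.
apply: le_trans (cK m.+1); rewrite normrM ler_piMr// ger0_norm ?invr_ge0//.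
by rewrite invf_le1// ler1n.
Qed.

Lemma egf_normed_cvg c s : geom_bounded c ->
  cvgn (series (fun m => `|s ^+ m / m`!%:R * c m|)).
Proof.
move=> [K cK].
apply: (@series_le_cvg _ _ (fun m => K * exp_coeff (2 * `|s|) m)).
- by move=> m.
- move=> m; have K0 : 0 <= K.
    by have := cK 0%N; rewrite expr0 mulr1; exact: le_trans.
  by rewrite mulr_ge0// exp_coeff_ge0// mulr_ge0.
- move=> m; rewrite normrM normrM normrX normfV (ger0_norm (ler0n _ _)).
  rewrite /exp_coeff/= exprMn.
  apply: le_trans (ler_wpM2l _ (cK m)) _; first by rewrite divr_ge0 ?exprn_ge0.
  by rewrite le_eqVlt; apply/orP; left; apply/eqP; ring.
- by have := @is_cvg_seriesZ _ _ K (is_cvg_series_exp_coeff (2 * `|s|)).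
Qed.

Lemma egf_cvg c s : geom_bounded c ->
  series (fun m => s ^+ m / m`!%:R * c m) @ \oo --> egf c s.
Proof. by move=> bc; apply: normed_cvg; exact: egf_normed_cvg. Qed.

Lemma eq_egf c d s : c =1 d -> egf c s = egf d s.
Proof. by move=> /funext->. Qed.

Lemma egfD c d s : geom_bounded c -> geom_bounded d ->
  egf (fun m => c m + d m) s = egf c s + egf d s.
Proof.
move=> bc bd; apply/cvg_lim => //.
rewrite (_ : (fun m => _) =
    (fun m => s ^+ m / m`!%:R * c m) + (fun m => s ^+ m / m`!%:R * d m)); last first.
  by apply/funext => m; rewrite mulrDr.
by rewrite seriesD; apply: cvgD; exact: egf_cvg.
Qed.

Lemma egfZ c (a : R) s : geom_bounded c ->
  egf (fun m => a * c m) s = a * egf c s.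
Proof.
move=> bc; apply/cvg_lim => //.
rewrite (_ : (fun m => _) = a *: (fun m => s ^+ m / m`!%:R * c m)); last first.
  by apply/funext => m; rewrite mulrCA.
by rewrite seriesZ; apply: cvgZl_tmp; exact: egf_cvg.
Qed.

Lemma egfB c d s : geom_bounded c -> geom_bounded d ->
  egf (fun m => c m - d m) s = egf c s - egf d s.
Proof.
move=> bc bd.
rewrite -[egf d s]mul1r -mulNr -egfZ// -egfD//; last exact: geom_boundedZ.
by apply: eq_egf => m; rewrite mulN1r.
Qed.

Lemma le_egf c d s : 0 <= s -> geom_bounded c -> geom_bounded d ->
  (forall m, c m <= d m) -> egf c s <= egf d s.
Proof.
move=> s0 bc bd cd; apply: lim_series_le.
- by apply/cvg_ex; exists (egf c s); exact: egf_cvg.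
- by apply/cvg_ex; exists (egf d s); exact: egf_cvg.
- by move=> m; rewrite ler_wpM2l// divr_ge0 ?exprn_ge0.
Qed.

Lemma egf_scale c (a s : R) : egf (fun m => a ^+ m * c m) s = egf c (a * s).
Proof.
by congr (limn (series _)); apply/funext => m; rewrite exprMn; ring.
Qed.

Lemma egf_const (a s : R) : egf (fun m => a ^+ m) s = expR (a * s).
Proof.
congr (limn (series _)); apply/funext => m.
by rewrite /exp_coeff/= exprMn; ring.
Qed.

Lemma egf1 s : egf (fun=> 1) s = expR s.
Proof.
rewrite -[s in RHS]mul1r -egf_const.
by apply: eq_egf => m; rewrite expr1n.
Qed.

Lemma egf0 s : egf (fun=> 0) s = 0.
Proof.
transitivity (0 * egf (fun=> 0) s); last exact: mul0r.
rewrite -egfZ; last first.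
  by apply: (@geom_bounded1 _ 0) => m; rewrite normr0.
by apply: eq_egf => m; rewrite mul0r.
Qed.

(** Since (m+1)! = (m+1) m!, dividing the shifted coefficients by m+1 makes multiplication by [s] a
    reindexing. Later, every factor [s] is traded in this way for an identity between
    coefficients. *)
Lemma egf_shift c s : geom_bounded c ->
  s * egf (fun m => c m.+1 / m.+1%:R) s = egf c s - c 0%N.
Proof.
move=> bc.
have bS := geom_bounded_shift bc.
rewrite -(cvg_lim (@Rhausdorff R) (@cvgMl_tmp _ _ _ _ _ s _ (egf_cvg (s := s) bS))).
apply/cvg_lim; first exact: Rhausdorff.
have : [sequence series (fun m => s ^+ m / m`!%:R * c m) n.+1 - c 0%N]_n
    @ \oo --> egf c s - c 0%N.
  apply: cvgB; last exact: cvg_cst.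
  by rewrite (cvg_shiftS (series _)); exact: egf_cvg.
apply: cvg_trans; apply: near_eq_cvg; near=> n.
rewrite /= /series/= big_nat_recl// expr0 fact0 divr1 mul1r addrC addKr.
rewrite mulr_sumr; apply: eq_bigr => i _.
rewrite factS natrM exprS; field.
by rewrite nat1r !pnatr_eq0 -!lt0n fact_gt0.
Unshelve. all: by end_near. Qed.

(** The first N antidiagonals fill the triangle i + j < N, which lies between the squares of sides
    N/2 and N. For absolute values this squeezes the triangle sums to the product of the limits, so
    the part of the square off the triangle tends to 0; it dominates the same part of the signed
    double sum. *)
Lemma cauchy_product_cvg (a b : nat -> R) (A B : R) :
  cvgn (series (fun i => `|a i|)) -> cvgn (series (fun i => `|b i|)) ->
  series a @ \oo --> A -> series b @ \oo --> B ->
  series (fun n => \sum_(i < n.+1) a i * b (n - i)%N) @ \oo --> A * B.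
Proof.
have convE (f g : nat -> R) N :
    series (fun n => \sum_(i < n.+1) f i * g (n - i)%N) N =
    \sum_(i < N) \sum_(j < N | (i + j < N)%N) f i * g j.
  rewrite /series/= big_mkord.
  transitivity (\sum_(n < N) \sum_(i < N | (i <= n)%N) f i * g (n - i)%N).
    apply: eq_bigr => n _; rewrite (big_ord_widen N (fun i => f i * g (n - i)%N))//.
  rewrite (exchange_big_dep xpredT)//=; apply: eq_bigr => i _.
  have iN := ltn_ord i.
  rewrite -(big_mkord (fun n => (i <= n)%N) (fun n => f i * g (n - i)%N)).
  rewrite -(big_mkord (fun j => (i + j < N)%N) (fun j => f i * g j)).
  move: (nat_of_ord i) iN => {}i iN.
  rewrite (big_cat_nat (leq0n i) (ltnW iN)) /=.
  rewrite big_nat_cond big_pred0 ?add0r; last first.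
    by move=> n; case: ltnP => //= ni; rewrite leqNgt ni.
  rewrite -{1}[i]add0n big_addn.
  rewrite [RHS](big_cat_nat (leq0n (N - i)%N) (leq_subr i N)) /=.
  rewrite [X in _ = _ + X]big_nat_cond [X in _ = _ + X]big_pred0 ?addr0; last first.
    by move=> n; rewrite leq_subLR ltnNge; case: leqP; rewrite ?andbF.
  rewrite big_nat_cond [RHS]big_nat_cond; apply: eq_big => [n|n _]; last by rewrite addnK.
  by rewrite leq_addl/= andbT ltn_subRL andbb.
move=> ca cb aA bB.
have prodE (f g : nat -> R) N : series f N * series g N =
    \sum_(i < N) \sum_(j < N) f i * g j.
  rewrite /series/= !big_mkord mulr_suml; apply: eq_bigr => i _.
  by rewrite mulr_sumr.
pose f i := `|a i|; pose g i := `|b i|.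
have half_le N : series f N./2 * series g N./2 <=
    series (fun n => \sum_(i < n.+1) f i * g (n - i)%N) N.
  rewrite convE prodE.
  have hN : (N./2 <= N)%N by rewrite -[leqRHS]odd_double_half -addnn addnA leq_addl.
  rewrite (big_ord_widen N (fun i => \sum_(j < N./2) f i * g j))// big_mkcond/=.
  apply: ler_sum => i _; case: ifPn => iN; last first.
    by apply: sumr_ge0 => j _; rewrite mulr_ge0 ?normr_ge0.
  rewrite (big_ord_widen N (fun j => f i * g j))//.
  rewrite big_mkcond/= [leRHS]big_mkcond/=; apply: ler_sum => j _.
  case: ifPn => jN; last by case: ifP => // _; rewrite mulr_ge0 ?normr_ge0.
  rewrite ifT// -[ltnRHS]odd_double_half -addnn addnA.
  apply: (@leq_trans (N./2 + N./2)%N); last by rewrite -addnA leq_addl.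
  by rewrite -addSn leq_add// ltnW.
have conv_le N : series (fun n => \sum_(i < n.+1) f i * g (n - i)%N) N <=
    series f N * series g N.
  rewrite convE prodE; apply: ler_sum => i _.
  rewrite big_mkcond/=; apply: ler_sum => j _.
  by case: ifP => // _; rewrite mulr_ge0 ?normr_ge0.
have half_oo : (N./2 @[N --> \oo] --> \oo).
  apply/cvgnyPge => K; exists (K.*2) => // N /= KN.
  by rewrite -[K]doubleK half_leq.
have FG : series f N * series g N @[N --> \oo] -->
    limn (series f) * limn (series g) by exact: cvgM.
have convFG : series (fun n => \sum_(i < n.+1) f i * g (n - i)%N) @ \oo -->
    limn (series f) * limn (series g).
  apply: (squeeze_cvgr _ _ FG); last first.
    exact: (cvg_comp (fun N => N./2) (fun N => series f N * series g N) half_oo FG).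
  by apply: nearW => N; rewrite half_le conv_le.
have AB : series a N * series b N @[N --> \oo] --> A * B by exact: cvgM.
suff dif : series a N * series b N -
    series (fun n => \sum_(i < n.+1) a i * b (n - i)%N) N @[N --> \oo] --> 0.
  rewrite -(subr0 (A * B)) (_ : series _ = (fun N => series a N * series b N -
      (series a N * series b N -
       series (fun n => \sum_(i < n.+1) a i * b (n - i)%N) N))); last first.
    by apply/funext => N; rewrite subKr.
  exact: (cvgB AB dif).
have FG0 : series f N * series g N -
    series (fun n => \sum_(i < n.+1) f i * g (n - i)%N) N @[N --> \oo] --> 0.
  by have := cvgB FG convFG; rewrite subrr; exact.
apply/cvgr0Pnorm_le => e e0.
move/cvgr0Pnorm_le : FG0 => /(_ _ e0); apply: filterS => N.
apply: le_trans; rewrite !prodE !convE.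
rewrite [leRHS]ger0_norm; last first.
  by have := conv_le N; rewrite convE prodE subr_ge0.
rewrite -!sumrB; apply: le_trans (ler_norm_sum _ _ _) _; apply: ler_sum => i _.
have split_row (h : 'I_N -> R) :
    \sum_(j < N) h j - \sum_(j < N | (i + j < N)%N) h j =
    \sum_(j < N | ~~ (i + j < N)%N) h j.
  by rewrite (bigID (fun j : 'I_N => (i + j < N)%N))/= addrAC subrr add0r.
rewrite !split_row.
apply: le_trans (ler_norm_sum _ _ _) _; apply: ler_sum => j _.
by rewrite normrM.
Qed.

End ExponentialSeries.

(** * Random walks on the half line *)

Section RadialWalk.
Variable R : realType.
Set Implicit Arguments.
Unset Strict Implicit.
Implicit Types (f : nat -> R) (k g t : R).

(** For L = 1 - P this is e^(-tL) = e^(-t) e^(tP): the binomial expansion of L^n makes the left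
    series the Cauchy product of the two exponential series. *)
Lemma egf_binomial (p l : nat -> R) t : geom_bounded p ->
  (forall n, l n = \sum_(j < n.+1) 'C(n, j)%:R * (-1) ^+ j * p j) ->
  limn (series (fun n => (- t) ^+ n / n`!%:R * l n)) = expR (- t) * egf p t.
Proof.
move=> bp lE; apply/cvg_lim => //.
have -> : (fun n => (- t) ^+ n / n`!%:R * l n) = (fun n => \sum_(i < n.+1)
    (t ^+ i / i`!%:R * p i) * ((- t) ^+ (n - i)%N / (n - i)`!%:R * 1)).
  apply/funext => n; rewrite lE mulr_sumr; apply: eq_bigr => -[i/=]; rewrite ltnS => iN _.
  have -> : n`!%:R = 'C(n, i)%:R * i`!%:R * (n - i)`!%:R :> R.
    by rewrite -!natrM -(bin_fact iN) mulnA.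
  have -> : (- t) ^+ n = (- t) ^+ (n - i) * ((-1) ^+ i * t ^+ i).
    by rewrite -exprMn mulN1r -exprD subnK.
  have ei : (-1) ^+ i * (-1) ^+ i = 1 :> R by rewrite -expr2 sqrr_sign.
  set e := (-1) ^+ i in ei *; set u := (- t) ^+ _.
  transitivity (e * e * (u * t ^+ i * p i / (i`!%:R * (n - i)`!%:R))).
    field; rewrite ?pnatr_eq0 -?lt0n ?fact_gt0 ?bin_gt0//.
  by rewrite ei; field; rewrite ?pnatr_eq0 -?lt0n ?fact_gt0.
have b1 : geom_bounded (fun=> 1 : R).
  by apply: (@geom_bounded1 _ _ 1) => m; rewrite normr1.
rewrite mulrC -egf1; apply: (@cauchy_product_cvg _ (fun i => t ^+ i / i`!%:R * p i)
  (fun i => (- t) ^+ i / i`!%:R * 1)).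
- exact: (egf_normed_cvg (s := t) bp).
- exact: (egf_normed_cvg (s := - t) b1).
- exact: (egf_cvg (s := t) bp).
- exact: (egf_cvg (s := - t) b1).
Qed.

(** The case [k = 1] is the simple walk on the integers folded at 0, where both neighbours of 0
    become 1. *)
Definition avg k f (n : nat) : R :=
  if n is m.+1 then (f m + f m.+2) / 2 else k * f 1%N.

Definition delta0 (n : nat) : R := (n == 0%N)%:R.

Definition walk k m : nat -> R := iter m (avg k) delta0.
Arguments walk : simpl never.

Lemma walkS0 k m : walk k m.+1 0 = k * walk k m 1. Proof. by []. Qed.

Lemma walkSS k m n : walk k m.+1 n.+1 = (walk k m n + walk k m n.+2) / 2.
Proof. by []. Qed.

Lemma walk_itv k m n : 0 <= k <= 1 -> 0 <= walk k m n <= 1.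
Proof.
move=> /andP[k0 k1]; elim: m n => [|m IH] n.
  by rewrite /walk/= /delta0; case: eqP; rewrite ?lexx ?ler01.
case: n => [|n]; last first.
  by rewrite walkSS; have := IH n; have := IH n.+2; lra.
by rewrite walkS0; have /andP[h0 h1] := IH 1%N; rewrite mulr_ge0//= mulr_ile1.
Qed.

Lemma walk_bounded k n : 0 <= k <= 1 -> geom_bounded (walk k ^~ n).
Proof.
move=> k01; apply: (@geom_bounded1 _ _ 1) => m.
by have /andP[h0 h1] := walk_itv m n k01; rewrite ger0_norm.
Qed.

Lemma iter_lazy_walk k g m n :
  iter m (fun f j => f j - g * avg k f j) delta0 n =
  \sum_(j < m.+1) 'C(m, j)%:R * (-1) ^+ j * (g ^+ j * walk k j n).
Proof.
elim: m n => [|m IH] n.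
  by rewrite big_ord1 bin0 !expr0 !mul1r.
rewrite iterS (funext IH).
have -> : g * avg k (fun n => \sum_(j < m.+1)
      'C(m, j)%:R * (-1) ^+ j * (g ^+ j * walk k j n)) n =
    \sum_(j < m.+1) 'C(m, j)%:R * (-1) ^+ j * (g ^+ j.+1 * walk k j.+1 n).
  case: n => [|n] /=.
    rewrite 2!mulr_sumr; apply: eq_bigr => i _; rewrite walkS0 exprS; ring.
  rewrite -big_split/= mulr_suml mulr_sumr; apply: eq_bigr => i _.
  by rewrite walkSS exprS; ring.
pose w j := (-1) ^+ j * (g ^+ j * walk k j n).
transitivity (\sum_(j < m.+1) 'C(m, j)%:R * w j + \sum_(j < m.+1) 'C(m, j)%:R * w j.+1).
  congr (_ + _); first by apply: eq_bigr => i _; rewrite -mulrA.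
  rewrite -sumrN; apply: eq_bigr => i _; rewrite /w [in RHS]exprS; ring.
transitivity (\sum_(j < m.+2) 'C(m.+1, j)%:R * w j); last first.
  by apply: eq_bigr => i _; rewrite -mulrA.
rewrite [RHS]big_ord_recl/= bin0 -[X in _ + X = _]addr0.
under [in RHS]eq_bigr => i _ do rewrite /bump leq0n add1n binS natrD mulrDl.
rewrite big_split/= [in RHS]addrA [RHS]addrC addr0 addrC; congr (_ + _).
rewrite big_ord_recl/= bin0; congr (_ + _).
rewrite [RHS]big_ord_recr/= bin_small// mul0r addr0.
by apply: eq_bigr => i _; rewrite /bump leq0n add1n.
Qed.

Lemma lazy_walk_heat k g t n : 0 <= k <= 1 -> `|g| <= 1 ->
  limn (series (fun m => (- t) ^+ m / m`!%:R *
     iter m (fun f j => f j - g * avg k f j) delta0 n)) =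
  expR (- t) * egf (walk k ^~ n) (g * t).
Proof.
move=> k01 g1; rewrite -egf_scale; apply: egf_binomial.
  by apply: geom_bounded_comp => //; exact: walk_bounded.
by move=> m; exact: iter_lazy_walk.
Qed.

(** For m + n even and n <= m, [walk 1 m n] is 2^-m C(m, (m-n)/2), and this is the ratio of
    consecutive binomial coefficients; for m + n odd both sides vanish. Without division or parity
    it goes through by induction on m. *)
Lemma simple_walk_ratio m n :
  (m%:R - n%:R) * walk 1 m n = (m%:R + n%:R + 2) * walk 1 m n.+2.
Proof.
have e i : i.+1%:R = i%:R + 1 :> R by rewrite natr1.
elim: m n => [|m IH] n.
  rewrite /walk/= /delta0; case: n => [|n]; by rewrite /= !mulr0 ?subrr ?mul0r.
have IHn := IH n.+1; rewrite (e m).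
case: n IHn => [|n] IHn.
  by rewrite walkS0 walkSS; move: IHn; rewrite mul1r; lra.
by have := IH n; rewrite !walkSS; move: IHn; rewrite !(e n.+1) !(e n); lra.
Qed.

(* With [k = (1 + q^-1) / 2] the reflection at the origin is exactly the one
   of the radial part of the walk on the tree, conjugated by [sqrt q ^ n]. *)
Lemma tree_walk_simple_walk (q : R) m n : q != 0 ->
  walk ((1 + q^-1) / 2) m n - q^-1 * walk ((1 + q^-1) / 2) m n.+2 =
  walk 1 m n - walk 1 m n.+2.
Proof.
move=> q0; elim: m n => [|m IH] n; first by rewrite /walk/= /delta0/= mulr0.
have IHn := IH n.+1.
case: n IHn => [|n] IHn.
  (* At the origin [k - q^-1 / 2 = 1 / 2], so both sides are half of those of the induction
     hypothesis at 1. *)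
  by rewrite !walkS0 !walkSS; lra.
by have := IH n; rewrite !walkSS; lra.
Qed.

Lemma simple_walk_return m :
  m.+2%:R * walk 1 m.+2 0 = m.+1%:R * walk 1 m 0.
Proof.
have := simple_walk_ratio m 0; rewrite walkS0 walkSS subr0 addr0 => h.
have e i : i.+1%:R = i%:R + 1 :> R by rewrite natr1.
by rewrite mul1r (e m.+1) (e m); lra.
Qed.

End RadialWalk.

(** * Radial functions on the tree and on the integers *)

Section TreeRadial.
Variables (R : realType) (q : nat) (T : choiceType) (adj : rel T).
Set Implicit Arguments.
Unset Strict Implicit.
Hypothesis hT : homogeneous_tree q adj.
Variable o : T.

Local Notation len x := (gdist adj x o).

Lemma gdist_spec x y : connected_by adj x y (gdist adj x y) /\
  forall n, connected_by adj x y n -> (gdist adj x y <= n)%N.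
Proof.
rewrite /gdist; case: pselect => [h|]; last by have := htree_connected hT x y.
by case: ex_minnP => n hn nmin; split.
Qed.

Lemma gdist_connected x y :
  exists p, [/\ path adj x p, last x p = y & size p = gdist adj x y].
Proof. by have [/asboolP] := gdist_spec x y. Qed.

Lemma gdist_min x p : path adj x p -> (gdist adj x (last x p) <= size p)%N.
Proof. by move=> xp; apply: (gdist_spec x (last x p)).2; apply/asboolP; exists p. Qed.

Lemma gdist_eq0 x y : (gdist adj x y == 0%N) = (x == y).
Proof.
apply/eqP/eqP => [d0|->]; last first.
  by apply/eqP; rewrite -leqn0; exact: (@gdist_min y [::]).
by have [p [_ py]] := gdist_connected x y; rewrite d0; case: p py.
Qed.

Lemma gdist_eq1 x y : gdist adj x y = 1%N <-> adj x y.
Proof.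
split=> [d1|xy].
  have [p [xp py]] := gdist_connected x y; rewrite d1.
  by case: p xp py => [|z [|]]//= /andP[xz _] <-.
have := @gdist_min x [:: y]; rewrite /= xy => /(_ isT).
rewrite leq_eqVlt ltnS leqn0 gdist_eq0 => /predU1P[//|/eqP xy0].
by move: xy; rewrite xy0 (htree_irr hT).
Qed.

Lemma len_adj x y : adj x y -> (len x <= (len y).+1)%N.
Proof.
move=> xy; have [p [yp yo <-]] := gdist_connected y o.
by have := @gdist_min x (y :: p); rewrite /= xy yo; exact.
Qed.

Lemma len_parent x n : len x = n.+1 -> exists2 y, adj x y & len y = n.
Proof.
move=> xn; have [[|y p] [/= xp po]] := gdist_connected x o.
  by rewrite xn.
move: xp => /andP[xy yp]; rewrite xn => -[pn]; exists y => //.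
apply/eqP; rewrite eqn_leq -{1}pn -{1}po gdist_min//=.
by rewrite -ltnS -xn; exact: len_adj.
Qed.

Lemma descending_path y : exists p, [/\ path adj y p, last y p = o &
  forall z, z \in p -> (len z < len y)%N].
Proof.
move n_def : (len y) => n; elim: n y n_def => [|n IH] y yn.
  exists [::]; split => //.
  by apply/eqP; rewrite -gdist_eq0; apply/eqP.
have [z yz zn] := len_parent yn; have [p [zp po plt]] := IH _ zn.
exists (z :: p); split; rewrite /= ?yz// => u.
by rewrite inE => /predU1P[->|/plt/ltnW]; rewrite ?zn.
Qed.

(* Two such neighbours could be joined by descending to [o], which avoids [x]. *)
Lemma adj_le_len_uniq x y z :
  adj x y -> adj x z -> (len y <= len x)%N -> (len z <= len x)%N -> y = z.
Proof.
move=> xy xz yx zx; apply/eqP; apply/negPn/negP => yz.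
have sym := htree_sym hT; have irr := htree_irr hT.
have avoid u p : adj x u -> (len u <= len x)%N ->
    (forall z, z \in p -> (len z < len u)%N) -> x \notin u :: p.
  move=> xu ux plt; rewrite inE negb_or; apply/andP; split.
    by apply: contraTneq xu => <-; rewrite irr.
  by apply/negP => /plt; rewrite ltnNge ux.
have [py [ypy pyo pylt]] := descending_path y.
have [pz [zpz pzo pzlt]] := descending_path z.
(* Descend from [y] to [o], then climb back to [z]; [belast] drops the endpoint [o], already reached
   by [py]. *)
pose p := py ++ rev (belast z pz).
have yp : path adj y p.
  rewrite cat_path ypy pyo -pzo rev_path /=.
  by rewrite (eq_path (e' := adj)) // => u v; rewrite sym.
have lastp : last y p = z.
  rewrite last_cat pyo; case: pz {p yp zpz pzlt} pzo => [//|u pz] _ /=.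
  by rewrite rev_cons last_rcons.
have xp : x \notin y :: p.
  have := avoid y py xy yx pylt; have := avoid z pz xz zx pzlt.
  rewrite !inE !negb_or mem_cat mem_rev => /andP[xz' xpz] /andP[-> xpy] /=.
  rewrite negb_or xpy/=; apply/negP => /mem_belast.
  by rewrite inE (negPf xz') (negPf xpz).
(* Loop erasure makes the walk simple. Closing it through [x] gives a cycle, which has at least
   three vertices because [y] and [z] differ. *)
case: (shortenP yp) lastp => p' yp' up' sub lastp'.
have := htree_acyclic hT (c := x :: y :: p').
rewrite /= rcons_path yp' lastp' xy (sym z) xz /= => /(_ _ isT) h.
have xp' : x \notin y :: p'.
  apply: contra xp; rewrite !inE => /orP[->//|/sub ->]; exact: orbT.
move: up' h => /= ->; rewrite xp' => /(_ isT).
case: p' lastp' {yp' sub xp'} => //= /eqP; by rewrite (negPf yz).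
Qed.

Lemma fsum_const_card (A : set T) n (F : T -> R) (c : R) :
  (A #= `I_n)%card -> (forall y, A y -> F y = c) ->
  \sum_(y \in A) F y = n%:R * c.
Proof.
move=> An Fc; rewrite (eq_fsbigr (fun=> c)); last by move=> y; rewrite inE; exact: Fc.
have /card_set_bijP[f bf] := An.
rewrite -(reindex_fsbig f A `I_n (fun=> c) bf).
by rewrite -(fsbig_ord _ n (fun=> c)) sumr_const card_ord mulr_natl.
Qed.

(** Away from [o] exactly one neighbour is closer ([len_parent]), and by [adj_le_len_uniq] no other
    one is closer or equally far, so the remaining [q] neighbours are farther. *)
Lemma tree_laplacian_radial (phi : nat -> R) x :
  tree_laplacian q adj (fun y => phi (len y)) x = phi (len x) - q.+1%:R^-1 *
    (if len x is n.+1 then phi n + q%:R * phi n.+2 else q.+1%:R * phi 1%N).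
Proof.
rewrite /tree_laplacian /=; congr (_ - _ * _).
have -> : [set y | gdist adj x y = 1%N] = [set y | adj x y].
  by apply/seteqP; split => y /= /gdist_eq1.
have Nq := htree_degree hT x.
have irr := htree_irr hT.
case xn : (len x) => [|n].
  apply: fsum_const_card => // y /= xy; congr phi.
  have xo : x = o by apply/eqP; rewrite -gdist_eq0 xn.
  have := len_adj (y := x) (x := y); rewrite (htree_sym hT) xy xn => /(_ isT).
  rewrite leq_eqVlt ltnS leqn0 gdist_eq0 => /predU1P[//|/eqP yo].
  by move: xy; rewrite yo xo irr.
have [z xz zn] := len_parent xn.
have finN : finite_set [set y | adj x y].
  by exists q.+1.
rewrite (fsbigD1 z)//= zn; congr (_ + _).
transitivity (\sum_(y \in [set y | adj x y] `\ z) phi n.+2).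
  apply: eq_fsbigr => y; rewrite inE => -[/= xy yz]; congr phi.
  have yx := len_adj (y := x) (x := y); rewrite (htree_sym hT) xy xn in yx.
  apply/eqP; rewrite eqn_leq yx//= ltnNge -xn; apply/negP => le_yx.
  by apply: yz; apply: adj_le_len_uniq xy xz le_yx _; rewrite zn xn.
(* The neighbours other than [z] are counted by summing the constant over all [q.+1] neighbours and
   cancelling the term at [z]. *)
have := @fsum_const_card _ _ (fun=> phi n.+2) (phi n.+2) Nq (fun _ _ => erefl).
rewrite (fsbigD1 z)//= => h.
by apply: (addrI (phi n.+2)); rewrite h -natr1 mulrDl mul1r addrC.
Qed.

Hypothesis q_gt0 : (0 < q)%N.

Let s : R := Num.sqrt q%:R.

(** As q = s^2, the factor s^-n balances the weights 1 and q of the two radial directions: each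
    becomes s/(q+1), half of [gamma0]. At the origin the weight becomes 1/s, which is [gamma0] times
    (1 + q^-1)/2. *)
Lemma tree_laplacian_iter m x :
  iter m (tree_laplacian q adj) (fun z => (z == o)%:R) x = s ^- len x *
  iter m (fun f j => f j - gamma0 R q * avg ((1 + q%:R^-1) / 2) f j)
    (@delta0 R) (len x).
Proof.
have qE : q%:R = s ^+ 2 :> R by rewrite sqr_sqrtr.
have s0 : s != 0 by rewrite gt_eqF// sqrtr_gt0 ltr0n.
have q1 : q.+1%:R = s ^+ 2 + 1 by rewrite -natr1 qE.
have q10 : s ^+ 2 + 1 != 0 by rewrite -q1 pnatr_eq0.
elim: m x => [|m IH] x.
  rewrite /= /delta0 -gdist_eq0; case: eqP => [->|_]; last by rewrite mulr0.
  by rewrite expr0 invr1 mulr1.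
rewrite iterS (funext IH).
set f := iter m _ _.
rewrite (tree_laplacian_radial (fun n => s ^- n * f n)) /= -/f.
rewrite /gamma0 -/s q1 qE; case: (len x) => [|n] /=.
  by rewrite expr0; field; rewrite s0 q10.
by rewrite !exprS; field; rewrite ?s0 ?q10 ?expf_neq0.
Qed.

Lemma gamma0_itv : 0 < gamma0 R q <= 1.
Proof.
have s0 : 0 < s by rewrite sqrtr_gt0 ltr0n.
rewrite /gamma0 -/s divr_gt0 ?mulr_gt0 ?ltr0n//= ler_pdivrMr ?ltr0n//.
have qE : q%:R = s ^+ 2 :> R by rewrite sqr_sqrtr.
by rewrite -[q.+1%:R]natr1 qE; have := sqr_ge0 (s - 1); rewrite sqrrB1; lra.
Qed.

Lemma tree_heatE t x : tree_heat q adj o t x = s ^- len x *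
  (expR (- t) * egf (walk ((1 + q%:R^-1) / 2) ^~ (len x)) (gamma0 R q * t)).
Proof.
set k := (1 + q%:R^-1) / 2.
have k01 : 0 <= k <= 1.
  have : 0 <= (q%:R^-1 : R) <= 1 by rewrite invr_ge0 ler0n invf_le1 ?ltr0n// ler1n.
  by rewrite /k; lra.
have [g0 g1] := andP gamma0_itv.
have bw : geom_bounded (fun j => gamma0 R q ^+ j * walk k j (len x)).
  apply: geom_bounded_comp; first exact: walk_bounded.
  by rewrite gtr0_norm.
rewrite /tree_heat /heat_kernel.
rewrite (egf_binomial (p := fun j => s ^- len x * (gamma0 R q ^+ j * walk k j (len x)))).
- by rewrite egfZ// egf_scale mulrCA.
- exact: geom_boundedZ.
- move=> n; rewrite tree_laplacian_iter iter_lazy_walk mulr_sumr.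
  by apply: eq_bigr => j _; rewrite mulrCA.
Qed.

End TreeRadial.

Section IntRadial.
Variable R : realType.

Lemma int_laplacian_iter m (j : int) :
  iter m (@int_laplacian R) (fun z => (z == 0)%:R) j =
  iter m (fun f n => f n - 1 * avg 1 f n) (@delta0 R) `|j|%N.
Proof.
elim: m j => [|m IH] j; first by rewrite /= /delta0 absz_eq0.
rewrite iterS (funext IH) /int_laplacian /=; set f := iter m _ _.
case: j => [[|n]|n].
- by rewrite /= !mul1r; lra.
- have -> : (n.+1%:Z + 1)%R = n.+2%:Z by rewrite !intS; ring.
  have -> : (n.+1%:Z - 1)%R = n%:Z by rewrite !intS; ring.
  by rewrite /= mul1r [X in X / 2]addrC.
- have -> : (Negz n + 1)%R = - n%:Z by rewrite NegzE !intS; ring.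
  have -> : (Negz n - 1)%R = - n.+2%:Z.
    by rewrite NegzE !intS; ring.
  by rewrite !abszN /= mul1r.
Qed.

Lemma int_heatE t n : int_heat t n%:Z = expR (- t) * egf (@walk R 1 ^~ n) t.
Proof.
rewrite /int_heat /heat_kernel -[t in egf _ t]mul1r.
rewrite -lazy_walk_heat ?ler01 ?lexx ?normr1//.
by congr (limn (series _)); apply/funext => m; rewrite int_laplacian_iter.
Qed.

End IntRadial.

(** * Ratios of Bessel functions *)

Section Bessel.
Variable R : realType.
Set Implicit Arguments.
Unset Strict Implicit.
Implicit Types (s : R) (n m : nat).

(** The modified Bessel function I_n. Its power series is grouped by the number of steps of the
    simple walk, so that identities for [walk] carry over. *)
Definition bessel n s : R := egf (@walk R 1 ^~ n) s.

Let one01 : 0 <= (1 : R) <= 1. Proof. by rewrite ler01 lexx. Qed.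

Lemma egf_gt0 (c : nat -> R) s m : 0 < s -> geom_bounded c ->
  (forall i, 0 <= c i) -> 0 < c m -> 0 < egf c s.
Proof.
move=> s0 bc c0 cm; set u := fun i => s ^+ i / i`!%:R * c i.
have u0 i : 0 <= u i by rewrite mulr_ge0// divr_ge0// exprn_ge0// ltW.
apply: (@lt_le_trans _ _ (series u m.+1)).
  rewrite seriesS ltr_wpDr//; first exact: sumr_ge0.
  by rewrite mulr_gt0// divr_gt0 ?exprn_gt0// ltr0n fact_gt0.
apply: nondecreasing_cvgn_le.
  by apply/nondecreasing_seqP => i; rewrite seriesS lerDr.
by apply/cvg_ex; exists (egf c s); exact: egf_cvg.
Qed.

Lemma walk_diag_gt0 n : 0 < walk (1 : R) n n.
Proof.
elim: n => [|n IH]; first by rewrite /walk/= /delta0/= ltr01.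
rewrite walkSS divr_gt0// ltr_pwDl//.
by have /andP[] := walk_itv n n.+2 one01.
Qed.

Lemma bessel_gt0 n s : 0 < s -> 0 < bessel n s.
Proof.
move=> s0; apply: (egf_gt0 (m := n)) => //.
- exact: walk_bounded.
- by move=> i; have /andP[] := walk_itv i n one01.
- exact: walk_diag_gt0.
Qed.

(** The series of [bessel n.+1] has no constant term, so [egf_shift] extracts a factor [s] from it;
    the rest is [simple_walk_ratio] coefficient by coefficient. *)
Lemma bessel_rec n s :
  s * (bessel n s - bessel n.+2 s) = 2 * n.+1%:R * bessel n.+1 s.
Proof.
have b i : geom_bounded (@walk R 1 ^~ i) by exact: walk_bounded.
have := egf_shift s (b n.+1).
rewrite {2}/walk /= /delta0 /= subr0 -/(bessel n.+1 s) => <-.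
rewrite mulrCA; congr (_ * _); rewrite /bessel -egfB// -egfZ; last first.
  exact: geom_bounded_shift (b n.+1).
apply: eq_egf => m.
have e i : i.+1%:R = i%:R + 1 :> R by rewrite natr1.
have m0 : m%:R + 1 != 0 :> R by rewrite natr1 pnatr_eq0.
have h := simple_walk_ratio R m n.
apply: (mulfI m0); rewrite [in LHS]mulrBr (e m) (e n).
transitivity ((n%:R + 1) * (walk (1 : R) m n + walk 1 m n.+2)); last by field.
by move: h; lra.
Qed.

Lemma bessel_le_linear n s : 0 < s ->
  2 * n.+1%:R * bessel n.+1 s <= s * bessel n s.
Proof.
move=> s0; rewrite -bessel_rec ler_wpM2l ?(ltW s0)//.
by rewrite lerBlDr lerDl ltW// bessel_gt0.
Qed.

(** The positive root of r (r + 2n/s) = 1, that is the fixed point of the continued fraction step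
    [bratioE] with its index frozen. *)
Definition rho n s : R := (Num.sqrt (n%:R ^+ 2 + s ^+ 2) - n%:R) / s.

Section FixedTime.
Variable s : R.
Hypothesis s_gt0 : 0 < s.

Let sn0 : s != 0. Proof. by rewrite gt_eqF. Qed.

Lemma rho_gt0 n : 0 < rho n s.
Proof.
rewrite divr_gt0// subr_gt0 -[ltLHS]ger0_norm// -sqrtr_sqr ltr_sqrt.
  by rewrite ltrDl exprn_gt0.
by rewrite ltr_wpDl ?sqr_ge0// exprn_gt0.
Qed.

Lemma rho_quadratic n : rho n s * (rho n s + 2 * n%:R / s) = 1.
Proof.
have h : Num.sqrt (n%:R ^+ 2 + s ^+ 2) ^+ 2 = n%:R ^+ 2 + s ^+ 2.
  by rewrite sqr_sqrtr// addr_ge0 ?sqr_ge0.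
rewrite /rho; set w := Num.sqrt _ in h *.
transitivity ((w ^+ 2 - n%:R ^+ 2) / s ^+ 2); first by field.
by rewrite h; field.
Qed.

Let lin_ge0 n : 0 <= 2 * n%:R / s.
Proof. by rewrite divr_ge0 ?(ltW s_gt0)// mulr_ge0. Qed.

Lemma rhoE n : rho n s = (rho n s + 2 * n%:R / s)^-1.
Proof.
have d0 : rho n s + 2 * n%:R / s != 0.
  by rewrite gt_eqF// ltr_pwDl// rho_gt0.
by apply: (mulIf d0); rewrite rho_quadratic mulVf.
Qed.

Lemma le_rho n (x : R) : 0 <= x -> x * (x + 2 * n%:R / s) <= 1 -> x <= rho n s.
Proof.
move=> x0; rewrite -[X in _ <= X -> _](rho_quadratic n).
apply: contraTT; rewrite -!ltNge => lt.
have ge0 := lin_ge0 n.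
have h := ltW (rho_gt0 n).
by apply: ltr_pM => //; [exact: addr_ge0|rewrite ltrD2r].
Qed.

Lemma rho_le1 n : rho n s <= 1.
Proof.
have ge0 := lin_ge0 n; have h := ltW (rho_gt0 n).
rewrite -(@expr_le1 _ 2)// -[X in _ <= X](rho_quadratic n) expr2 ler_wpM2l//.
by rewrite lerDl.
Qed.

Lemma rho_ge n : 1 - n%:R / s <= rho n s.
Proof.
rewrite /rho mulrBl lerD2r ler_pdivlMr// mul1r.
have s0 := ltW s_gt0.
rewrite -[leLHS]ger0_norm// -sqrtr_sqr ler_sqrt.
  by rewrite lerDr sqr_ge0.
by rewrite addr_ge0 ?sqr_ge0.
Qed.

Lemma rho_nonincr n m : (n <= m)%N -> rho m s <= rho n s.
Proof.
move=> nm; have h := ltW (rho_gt0 m); apply: le_rho => //.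
rewrite -[X in _ <= X](rho_quadratic m) ler_wpM2l// lerD2l.
by rewrite ler_pM2r ?invr_gt0// ler_wpM2l// ler_nat.
Qed.

(** Each side is a square root plus n, over s: the jump by two indices is what makes the linear
    terms agree. Hence the descent in steps of two. *)
Lemma rho_shift2 n : rho n s + 2 * n%:R / s <= rho n.+2 s + 2 * n.+1%:R / s.
Proof.
rewrite /rho -!mulrDl ler_pM2r ?invr_gt0//.
have : Num.sqrt (n%:R ^+ 2 + s ^+ 2) <= Num.sqrt (n.+2%:R ^+ 2 + s ^+ 2).
  rewrite ler_sqrt ?addr_ge0 ?sqr_ge0// lerD2r ler_sqr ?nnegrE// ler_nat.
  exact: leqW.
have e i : i.+1%:R = i%:R + 1 :> R by rewrite natr1.
by rewrite !(e n.+1) !(e n); lra.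
Qed.

Definition bratio n : R := bessel n.+1 s / bessel n s.

Lemma bratio_gt0 n : 0 < bratio n.
Proof. by rewrite divr_gt0 ?bessel_gt0. Qed.

Lemma bratioE n : bratio n = (bratio n.+1 + 2 * n.+1%:R / s)^-1.
Proof.
have B i : bessel i s != 0 by rewrite gt_eqF// bessel_gt0.
have /eqP := bessel_rec n s.
rewrite mulrBr subr_eq => /eqP h.
have hn : bessel n s = bessel n.+2 s + 2 * n.+1%:R / s * bessel n.+1 s.
  by apply: (mulfI sn0); rewrite h; field.
have -> : bratio n.+1 + 2 * n.+1%:R / s = bessel n s / bessel n.+1 s.
  by rewrite hn /bratio; field; rewrite B sn0.
by rewrite invf_div.
Qed.

(** The map in [bratioE] is decreasing, so an upper bound at one index gives a lower bound at the
    previous one, and conversely in [bratio_le]. *)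
Lemma bratio_ge n : bratio n.+1 <= rho n.+1 s -> rho n.+1 s <= bratio n.
Proof.
move=> h; rewrite bratioE rhoE lef_pV2 ?lerD2r// posrE ltr_pwDl//.
- exact: rho_gt0.
- exact: bratio_gt0.
Qed.

Lemma bratio_le n : rho n.+2 s <= bratio n.+1 -> bratio n <= rho n s.
Proof.
move=> h; rewrite bratioE [leRHS]rhoE lef_pV2.
- by apply: le_trans (rho_shift2 n) _; rewrite lerD2r.
- by rewrite posrE ltr_pwDl// bratio_gt0.
- by rewrite posrE ltr_pwDl// rho_gt0.
Qed.

(** The crude bound s/(2(n+1)) on the ratio satisfies the quadratic inequality of [le_rho] exactly
    when s^2/4 <= n+1. *)
Lemma bratio_le_rho_large n : s ^+ 2 <= 4 * n.+1%:R -> bratio n <= rho n s.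
Proof.
move=> sn; have b0 := ltW (bratio_gt0 n); apply: le_rho => //.
have n0 : 0 < n.+1%:R :> R by rewrite ltr0n.
have h : bratio n <= s / (2 * n.+1%:R).
  rewrite ler_pdivrMr ?bessel_gt0// mulrAC ler_pdivlMr ?mulr_gt0//.
  by rewrite mulrC bessel_le_linear.
have ge0 := lin_ge0 n.
apply: (@le_trans _ _ (s / (2 * n.+1%:R) * (s / (2 * n.+1%:R) + 2 * n%:R / s))).
  by rewrite ler_pM// ?addr_ge0// lerD2r.
have -> : s / (2 * n.+1%:R) * (s / (2 * n.+1%:R) + 2 * n%:R / s) =
    (s ^+ 2 / 4 + n%:R * n.+1%:R) / n.+1%:R ^+ 2.
  by field; rewrite nat1r sn0 gt_eqF.
rewrite ler_pdivrMr ?exprn_gt0// mul1r [X in _ <= X]expr2.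
have -> : n.+1%:R * n.+1%:R = n.+1%:R + n%:R * n.+1%:R :> R.
  by rewrite -{1}natr1 mulrDl mul1r addrC.
by rewrite lerD2r; lra.
Qed.

(* The bound propagates downwards two steps at a time, so that it follows from
   its validity for all large indices. *)
Lemma bratio_le_rho n : bratio n <= rho n s.
Proof.
have down k : bratio (n + k.*2) <= rho (n + k.*2) s -> bratio n <= rho n s.
  elim: k n => [|k IH] i; first by rewrite addn0.
  rewrite doubleS !addnS -!addSn => h.
  by apply: bratio_le; apply: bratio_ge; exact: IH.
have [k kP] : exists k : nat, s ^+ 2 <= k%:R.
  by exists (Num.bound (s ^+ 2)); exact/ltW/archi_boundP/sqr_ge0.
apply: (down k); apply: bratio_le_rho_large; apply: le_trans kP _.
by rewrite -natrM ler_nat; lia.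
Qed.

Lemma rho_le_bratio n : rho n.+1 s <= bratio n.
Proof. exact/bratio_ge/bratio_le_rho. Qed.

Lemma bessel_nonincr n m : (n <= m)%N -> bessel m s <= bessel n s.
Proof.
elim: m => [|m IH]; first by rewrite leqn0 => /eqP ->.
rewrite leq_eqVlt ltnS => /predU1P[->//|/IH]; apply: le_trans.
rewrite -[leRHS]mul1r -ler_pdivrMr ?bessel_gt0//.
exact: le_trans (bratio_le_rho m) (rho_le1 m).
Qed.

(** Step j loses at most the fraction (j+1)/s of I_j, hence of I_0. The losses add up to
    n(n+1)/(2s), which is at most n^2/s. *)
Lemma bessel_ge n : bessel 0 s * (1 - n%:R ^+ 2 / s) <= bessel n s.
Proof.
have e i : i.+1%:R = i%:R + 1 :> R by rewrite natr1.
elim: n => [|n IH]; first by rewrite expr0n/= mul0r subr0 mulr1.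
have B0 := bessel_gt0 0 s_gt0; have Bn := bessel_gt0 n s_gt0.
have h : (1 - n.+1%:R / s) * bessel n s <= bessel n.+1 s.
  rewrite -ler_pdivlMr//; exact: le_trans (rho_ge _) (rho_le_bratio _).
have h2 : bessel n s * (n.+1%:R / s) <= bessel 0 s * (n.+1%:R / s).
  by rewrite ler_wpM2r ?bessel_nonincr// divr_ge0// ltW.
apply: le_trans h; rewrite mulrBl mul1r.
have -> : n.+1%:R ^+ 2 / s = n%:R ^+ 2 / s + (n.+1%:R / s + n%:R / s) :> R.
  by rewrite e; field.
have h3 : 0 <= bessel 0 s * (n%:R / s).
  by rewrite mulr_ge0 ?divr_ge0// ltW.
move: IH h2 h3; rewrite [bessel n s * (_ / _)]mulrC; lra.
Qed.

End FixedTime.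
End Bessel.

(** * Wallis' inequalities and Bessel functions for large time *)

Section Wallis.
Variable R : realType.
Set Implicit Arguments.
Unset Strict Implicit.
Implicit Types (x : R) (n m : nat).

(** The primitive of sin^n vanishing at 0, given by the reduction formula. Its value at pi/2 is the
    Wallis integral, and comparing two such integrals becomes a sign of a derivative. *)
Fixpoint sin_primitive n x : R :=
  match n with
  | 0%N => x
  | 1%N => 1 - cos x
  | (k.+1 as m).+1 =>
      (m%:R * sin_primitive k x - sin x ^+ m * cos x) / m.+1%:R
  end.

Lemma is_derive_sin_primitive n x :
  is_derive x 1 (sin_primitive n) (sin x ^+ n).
Proof.
suff : is_derive x 1 (sin_primitive n) (sin x ^+ n) /\
    is_derive x 1 (sin_primitive n.+1) (sin x ^+ n.+1) by case.
elim: n => [|n [IH0 IH1]].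
  split; first by rewrite expr0; exact: is_derive_id.
  apply: is_derive_eq.
by rewrite add0r mul1r opprK expr1.
split=> //.
have e : sin_primitive n.+2 =
    n.+2%:R^-1 *: (n.+1%:R *: sin_primitive n - sin ^+ n.+1 * cos).
  by apply/funext => y; rewrite /= mulrC /GRing.scale/= !fctE.
rewrite e; apply: is_derive_eq.
have -> : (sin ^+ n.+1) x = sin x ^+ n.+1 by rewrite fctE.
rewrite /GRing.scale/= !exprS.
have n2 : n.+2%:R != 0 :> R by rewrite pnatr_eq0.
have cE : cos x * cos x = 1 - sin x * sin x.
  by rewrite -!expr2 -(cos2Dsin2 x) addrK.
set S := sin x ^+ n in cE *.
transitivity (n.+2%:R^-1 * S * (n.+1%:R * (1 - cos x * cos x) + sin x * sin x)).
  by ring.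
rewrite cE -[n.+2%:R]natr1 in n2 *; field.
by move: n2; rewrite -natr1; congr (_ != _); ring.
Qed.

Lemma sin_primitive0 n : sin_primitive n 0 = 0.
Proof.
suff : sin_primitive n 0 = 0 /\ sin_primitive n.+1 0 = 0 by case.
elim: n => [|n [IH0 IH1]]; first by rewrite /= cos0 subrr.
by split=> //=; rewrite IH0 sin0 expr0n/= mulr0 mul0r subr0 mul0r.
Qed.

Definition wallis n : R := sin_primitive n (pi / 2).

Lemma wallis_rec n : n.+2%:R * wallis n.+2 = n.+1%:R * wallis n.
Proof.
by rewrite /wallis/= cos_pihalf mulr0 subr0 mulrC divfK// pnatr_eq0.
Qed.

Lemma wallis_nonincr n : wallis n.+1 <= wallis n.
Proof.
have pi2 : 0 <= pi / 2 :> R by rewrite divr_ge0// pi_ge0.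
rewrite -subr_ge0 -[leLHS](subrr 0).
have dF x : is_derive x 1 (sin_primitive n - sin_primitive n.+1)
    (sin x ^+ n - sin x ^+ n.+1).
  by apply: is_deriveB; exact: is_derive_sin_primitive.
have := @ger0_derive1_ndecr R (sin_primitive n - sin_primitive n.+1) 0 (pi / 2).
move=> /(_ _ _ _ 0 (pi / 2)); rewrite !fctE !sin_primitive0; apply => //.
- move=> x; rewrite in_itv/= => /andP[x0 x1].
  rewrite derive1E derive_val exprS -[X in X - _]mul1r -mulrBl.
  rewrite mulr_ge0 ?subr_ge0 ?sin_le1// exprn_ge0// sin_ge0_pi// ltW//=.
  by rewrite (le_trans (ltW x1))// ler_pdivrMr// ler_peMr ?pi_ge0// ler1n.
- apply: derivable_within_continuous => x _; exact: (@ex_derive _ _ _ _ _ _ _ (dF x)).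
Qed.

Lemma wallis0 : wallis 0 = pi / 2. Proof. by []. Qed.

Lemma wallis1 : wallis 1 = 1.
Proof. by rewrite /wallis/= cos_pihalf subr0. Qed.

Lemma wallis_gt0 n : 0 < wallis n.
Proof.
suff : 0 < wallis n /\ 0 < wallis n.+1 by case.
elim: n => [|n [IH0 IH1]].
  by rewrite wallis0 wallis1 ltr01 divr_gt0// pi_gt0.
split=> //; have n2 : 0 < n.+2%:R :> R by rewrite ltr0n.
by rewrite -(pmulr_rgt0 _ n2) wallis_rec mulr_gt0// ltr0n.
Qed.

Lemma wallis_mul n : n.+1%:R * (wallis n * wallis n.+1) = pi / 2.
Proof.
elim: n => [|n IH]; first by rewrite wallis0 wallis1 mul1r mulr1.
by rewrite -IH mulrCA wallis_rec mulrCA; congr (_ * _); exact: mulrC.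
Qed.

Lemma wallis_sqr_ge n : pi / 2 <= n.+1%:R * wallis n ^+ 2.
Proof.
rewrite -(wallis_mul n) ler_wpM2l// expr2 ler_wpM2l ?wallis_nonincr//.
exact/ltW/wallis_gt0.
Qed.

Lemma wallis_sqr_le n : n%:R * wallis n ^+ 2 <= pi / 2.
Proof.
case: n => [|n]; first by rewrite mul0r divr_ge0// pi_ge0.
rewrite -(wallis_mul n) ler_wpM2l// expr2 ler_wpM2r ?wallis_nonincr//.
exact/ltW/wallis_gt0.
Qed.

(** The indicator of the even numbers, written with signs so that its exponential series is visibly
    cosh. *)
Definition even01 m : R := (1 + (-1) ^+ m) / 2.
Definition odd01 m : R := (1 - (-1) ^+ m) / 2.

Lemma even01_itv m : 0 <= even01 m <= 1.
Proof. by rewrite /even01 -signr_odd; case: odd; lra. Qed.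

(** Both sides agree at 0 and 1 and satisfy the same two-step recurrence, [simple_walk_return] and
    [wallis_rec]. *)
Lemma return_wallis m : walk 1 m 0 = even01 m * (2 / pi * wallis m).
Proof.
have pi0 : pi != 0 :> R by rewrite gt_eqF// pi_gt0.
suff : walk 1 m 0 = even01 m * (2 / pi * wallis m) /\
    walk 1 m.+1 0 = even01 m.+1 * (2 / pi * wallis m.+1) by case.
elim: m => [|m [IH0 IH1]].
  rewrite wallis0 wallis1 /even01 expr0 expr1 /walk/= /delta0/=.
  split; last by rewrite subrr !mul0r mulr0.
  by move: (pi : R) pi0 => p p0; field.
split=> //; have m2 : m.+2%:R != 0 :> R by rewrite pnatr_eq0.
apply: (mulfI m2); rewrite simple_walk_return IH0.
have -> : even01 m.+2 = even01 m by rewrite /even01 !exprS mulrA mulrNN !mul1r.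
by rewrite mulrCA (mulrCA m.+1%:R) -wallis_rec; ring.
Qed.

End Wallis.

Section BesselZero.
Variable R : realType.
Set Implicit Arguments.
Unset Strict Implicit.
Variable s : R.
Hypothesis s_gt0 : 0 < s.

(** For even m the return probability is about sqrt(2/(pi m)); [a] is this at the Poisson mean m =
    s. *)
Let a : R := Num.sqrt (2 / (pi * s)).

Let a_gt0 : 0 < a.
Proof. by rewrite sqrtr_gt0 divr_gt0// mulr_gt0// pi_gt0. Qed.

Let a_sqr : a ^+ 2 = 2 / (pi * s).
Proof. by rewrite sqr_sqrtr// divr_ge0// mulr_ge0 ?pi_ge0// ltW. Qed.

(* [(3 - z) / 2] is the tangent at [z = 1] of the convex function [z^(-1/2)]. *)
Lemma return_ge m : even01 R m * (a * (3 / 2 - m.+1%:R / (2 * s))) <= walk 1 m 0.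
Proof.
have pi0 : 0 < pi :> R := pi_gt0 R.
rewrite return_wallis; have /andP[e0 _] := even01_itv R m; apply: ler_wpM2l => //.
have m0 : 0 < m.+1%:R :> R by rewrite ltr0n.
have w0 := wallis_gt0 R m.
set z := m.+1%:R / s; have z0 : 0 < z by rewrite divr_gt0.
have -> : m.+1%:R / (2 * s) = z / 2 by rewrite /z; field; rewrite gt_eqF.
set u := 2 / pi * wallis R m / a.
have u0 : 0 <= u by rewrite divr_ge0 ?(ltW a_gt0)// mulr_ge0 ?divr_ge0 ?(ltW pi0)// ltW.
have -> : 2 / pi * wallis R m = a * u 
  by rewrite /u; move: (pi : R) pi0 => p p0; field; rewrite !gt_eqF.
rewrite ler_pM2l//.
have uz : 1 <= u ^+ 2 * z.
  have := wallis_sqr_ge R m; rewrite /u /z !exprMn !exprVn a_sqr => h.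
  apply: (@le_trans _ _ ((2 / pi) * (m.+1%:R * wallis R m ^+ 2))).
    by rewrite -ler_pdivrMl ?divr_gt0// invf_div mulr1.
  rewrite le_eqVlt; apply/orP; left; apply/eqP.
  by move: (pi : R) pi0 => p p0; field; rewrite !gt_eqF.
have [z3|z3] := leP 3 z; first by apply: le_trans u0; lra.
have -> : 3 / 2 - z / 2 = (3 - z) / 2 by lra.
have z3' : 0 <= (3 - z) / 2 by lra.
rewrite -ler_sqr ?nnegrE//.
rewrite -(ler_pM2r z0); apply: le_trans uz.
(* Expanded, this is (3 - z)^2 z <= 4, the squared tangent inequality. *)
have : 0 <= (1 - z) ^+ 2 * (4 - z) by rewrite mulr_ge0 ?sqr_ge0//; lra.
by lra.
Qed.

(* AM-GM: [u <= (1 + u^2) / 2] *)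
Lemma return_le m : walk 1 m 0 <= even01 R m *
  (a / 2 * (1 + s / m.+1%:R + 4 * s / (m.+1%:R * m.+2%:R))).
Proof.
have pi0 : 0 < pi :> R := pi_gt0 R.
rewrite return_wallis; have /andP[e0 _] := even01_itv R m; apply: ler_wpM2l => //.
have w0 := wallis_gt0 R m.
set u := 2 / pi * wallis R m / a.
have -> : 2 / pi * wallis R m = a * u 
  by rewrite /u; move: (pi : R) pi0 => p p0; field; rewrite !gt_eqF.
rewrite -mulrA ler_pM2l//.
have amgm : u <= (1 + u ^+ 2) / 2.
  by have := sqr_ge0 (u - 1); rewrite sqrrB1; lra.
apply: le_trans amgm _; rewrite mulrC ler_pM2l ?invr_gt0// -addrA lerD2l.
have -> : u ^+ 2 = s * (2 / pi * wallis R m ^+ 2).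
  rewrite /u !exprMn !exprVn a_sqr.
  by move: (pi : R) pi0 => p p0; field; rewrite !gt_eqF.
rewrite [leRHS](_ : _ = s * (m.+1%:R^-1 + 4 / (m.+1%:R * m.+2%:R))); last first.
  by ring.
rewrite ler_pM2l//.
(* Wallis gives 1/m, which is useless at m = 0 and has no elementary Poisson mean; both terms here
   are summed exactly by [egf_shift]. The constant 4 covers the difference 1/(m(m+1)) for m >= 1 as
   well as the case m = 0. *)
suff : wallis R m ^+ 2 <= pi / 2 * (m.+1%:R^-1 + 4 / (m.+1%:R * m.+2%:R)).
  by rewrite -ler_pdivrMl ?divr_gt0// invf_div.
have pi4 : pi / 2 < 2 :> R by exact: pihalf_lt2.
case: m {e0 u} w0 => [|m] w0.
  rewrite wallis0 expr2; apply: ler_wpM2l; first by rewrite divr_ge0// ltW.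
  by rewrite invr1; lra.
have m1 : 0 < m.+1%:R :> R by rewrite ltr0n.
have := wallis_sqr_le R m.+1; rewrite mulrC -ler_pdivlMr// => /le_trans; apply.
rewrite ler_wpM2l ?divr_ge0 ?(ltW pi0)//.
have -> : m.+3%:R = m.+1%:R + 2 :> R by rewrite -natrD addn2.
have -> : m.+2%:R = m.+1%:R + 1 :> R by rewrite natr1.
have mge : 1 <= m.+1%:R :> R by rewrite ler1n.
move: m.+1%:R m1 mge => x x0 x1.
rewrite -subr_ge0 (_ : _ - _ = (3 * x - 2) / (x * (x + 1) * (x + 2))); last first.
  by field; rewrite !gt_eqF//; lra.
by rewrite divr_ge0//; [lra|rewrite !mulr_ge0//; lra].
Qed.

(** * Poisson moments restricted to even numbers of steps *)

Let ch : R := (expR s + expR (- s)) / 2.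
Let sh : R := (expR s - expR (- s)) / 2.

Let bounded_one : geom_bounded (fun=> 1 : R).
Proof. by apply: (@geom_bounded1 _ _ 1) => m; rewrite normr1. Qed.

Let bounded_sign : geom_bounded (fun m => (-1) ^+ m : R).
Proof. by apply: (@geom_bounded1 _ _ 1) => m; rewrite normrX normrN1 expr1n. Qed.

Let bounded_even : geom_bounded (even01 R).
Proof.
apply: (@geom_bounded1 _ _ 1) => m.
by have /andP[h0 h1] := even01_itv R m; rewrite ger0_norm.
Qed.

Let bounded_odd : geom_bounded (odd01 R).
Proof.
apply: (@geom_bounded1 _ _ 1) => m; rewrite /odd01 -signr_odd.
by case: odd; rewrite ger0_norm; lra.
Qed.

Let bounded_even_nat : geom_bounded (fun m => m%:R * even01 R m).
Proof.
have [K bK] := geom_bounded_nat R; exists K => m; apply: le_trans (bK m).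
have /andP[h0 h1] := even01_itv R m.
by rewrite normrM ler_piMr// ger0_norm.
Qed.

Lemma egf_even : egf (even01 R) s = ch.
Proof.
rewrite (eq_egf (d := fun m => 2^-1 * (1 + (-1) ^+ m))); last first.
  by move=> m; rewrite /even01 mulrC.
rewrite egfZ; last exact: geom_boundedD.
by rewrite egfD// egf1 egf_const mulN1r mulrC.
Qed.

Lemma egf_odd : egf (odd01 R) s = sh.
Proof.
rewrite (eq_egf (d := fun m => 1 - even01 R m)); last first.
  by move=> m; rewrite /odd01 /even01; lra.
by rewrite egfB// egf1 egf_even /ch /sh; lra.
Qed.

Let evenS m : even01 R m.+1 = odd01 R m.
Proof. by rewrite /even01 /odd01 exprS mulN1r. Qed.

Let oddS m : odd01 R m.+1 = even01 R m.
Proof. by rewrite /even01 /odd01 exprS mulN1r opprK. Qed.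

Let odd0 : odd01 R 0 = 0. Proof. by rewrite /odd01 subrr mul0r. Qed.

(** Each inverse factor, m+1 and then m+2, is absorbed by one shift, and each shift exchanges even
    and odd. *)
Lemma egf_even_div : s * egf (fun m => even01 R m / m.+1%:R) s = sh.
Proof.
rewrite -egf_odd -[RHS](subr0) -[X in _ = _ - X]odd0 -egf_shift//.
by congr (_ * _); apply: eq_egf => m; rewrite oddS.
Qed.

Lemma egf_even_div2 :
  s * (s * egf (fun m => even01 R m / (m.+1%:R * m.+2%:R)) s) = ch - 1.
Proof.
have e0 : even01 R 0 = 1 by rewrite /even01 expr0 divff.
transitivity (s * egf (fun m => odd01 R m / m.+1%:R) s); last first.
  rewrite -egf_even -[X in _ = _ - X]e0 -egf_shift//.
  by congr (_ * _); apply: eq_egf => m; rewrite evenS.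
congr (_ * _); rewrite -[RHS]subr0 -[X in _ = _ - X](mul0r 1%:R^-1).
rewrite -[X in X / 1%:R]odd0 -(egf_shift (c := fun m => odd01 R m / m.+1%:R)).
  congr (_ * _); apply: eq_egf => m.
  by rewrite oddS invfM mulrA mulrAC.
rewrite (_ : (fun m => _) = (fun m => even01 R m.+1 / m.+1%:R)); last first.
  by apply/funext => m; rewrite evenS.
exact: geom_bounded_shift bounded_even.
Qed.

Lemma egf_even_nat : egf (fun m => m%:R * even01 R m) s = s * sh.
Proof.
rewrite -[LHS]subr0 -[X in _ - X](mul0r (even01 R 0)).
rewrite -(egf_shift (c := fun m => m%:R * even01 R m))// -egf_odd.
congr (_ * _); apply: eq_egf => m.
by rewrite evenS mulrC mulKf// pnatr_eq0.
Qed.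

Let norm : R := Num.sqrt (2 * pi * s) * expR (- s).

Let norm_a : Num.sqrt (2 * pi * s) * a = 2.
Proof.
have pi0 : 0 < pi :> R := pi_gt0 R.
rewrite -sqrtrM; last by rewrite !mulr_ge0// ltW.
rewrite (_ : _ * _ = 2 ^+ 2) ?sqrtr_sqr ?ger0_norm//.
by move: (pi : R) pi0 => p p0; field; rewrite !gt_eqF.
Qed.

(** The expected size of [bessel 0 s] is [a * ch], about [a / 2 * expR s], and [norm] is the inverse
    of the latter. *)
Let norm_a_exp : norm * (a / 2 * expR s) = 1.
Proof.
by rewrite /norm mulrACA [X in X * _]mulrA norm_a divff// mul1r -expRD addNr expR0.
Qed.

Let norm_ge0 : 0 <= norm.
Proof. by rewrite mulr_ge0 ?sqrtr_ge0// expR_ge0. Qed.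

Let emlt : expR (- s) <= 1.
Proof. by rewrite -expR0 ler_expR oppr_le0 ltW. Qed.

Let eplt : 1 <= expR s.
Proof. by rewrite -expR0 ler_expR ltW. Qed.

Let bounded_return : geom_bounded (fun m => walk (1 : R) m 0).
Proof. by apply: (@walk_bounded R 1 0); rewrite ler01 lexx. Qed.

(** On averaging [return_le], the two leading terms give [ch + sh], which is exactly [expR s]; only
    the correction term contributes to 4/s. *)
Lemma bessel0_le : norm * bessel 0 s <= 1 + 4 / s.
Proof.
have s0 := ltW s_gt0.
pose d m := even01 R m + (s * (even01 R m / m.+1%:R) +
  4 * s * (even01 R m / (m.+1%:R * m.+2%:R))).
have b1 : geom_bounded (fun m => even01 R m / m.+1%:R).
  rewrite (_ : (fun m => _) = (fun m => odd01 R m.+1 / m.+1%:R)).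
    exact: geom_bounded_shift bounded_odd.
  by apply/funext => m; rewrite oddS.
have b2 : geom_bounded (fun m => even01 R m / (m.+1%:R * m.+2%:R)).
  have [K bK] := bounded_even; exists K => m; apply: le_trans (bK m).
  rewrite normrM ler_piMr// ger0_norm ?invr_ge0 ?mulr_ge0//.
  by rewrite invf_le1 ?mulr_gt0 ?ltr0n// -natrM ler1n muln_gt0.
have bs : geom_bounded (fun m => s * (even01 R m / m.+1%:R)) by exact: geom_boundedZ.
have b4 : geom_bounded (fun m => 4 * s * (even01 R m / (m.+1%:R * m.+2%:R))).
  exact: geom_boundedZ.
have bd : geom_bounded d by apply: geom_boundedD => //; exact: geom_boundedD.
have dE : egf d s = ch + (sh + 4 * (ch - 1) / s).
  rewrite egfD//; last exact: geom_boundedD.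
  rewrite egfD// !egfZ// egf_even egf_even_div -egf_even_div2.
  by congr (_ + (_ + _)); field; rewrite gt_eqF.
have : bessel 0 s <= a / 2 * expR s * (1 + 4 / s).
  apply: (@le_trans _ _ (egf (fun m => a / 2 * d m) s)).
    apply: le_egf => //; first exact: geom_boundedZ.
    by move=> m; apply: le_trans (return_le m) _; rewrite le_eqVlt /d;
      apply/orP; left; apply/eqP; ring.
  rewrite egfZ// dE -[leRHS]mulrA ler_wpM2l ?divr_ge0 ?(ltW a_gt0)//.
  rewrite [leRHS]mulrDr mulr1 addrA /ch /sh; apply: lerD; first by lra.
  by rewrite [leRHS]mulrA ler_wpM2r ?invr_ge0//; have := emlt; have := eplt; lra.
move=> /(ler_wpM2l norm_ge0)/le_trans; apply.
by rewrite mulrA norm_a_exp mul1r.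
Qed.

(** On averaging the tangent bound [return_ge], the slope takes 1/2 off 3/2 to leading order; the
    remaining loss is at most 1/s. *)
Lemma bessel0_ge : 1 - 1 / s <= norm * bessel 0 s.
Proof.
have s0 := ltW s_gt0.
pose d m := (3 / 2 - 1 / (2 * s)) * even01 R m - 1 / (2 * s) * (m%:R * even01 R m).
have bz (c : R) : geom_bounded (fun m => c * even01 R m) by exact: geom_boundedZ.
have bn (c : R) : geom_bounded (fun m => c * (m%:R * even01 R m)).
  exact: geom_boundedZ.
have dE : egf d s = (3 / 2 - 1 / (2 * s)) * ch - sh / 2.
  rewrite egfB// !egfZ// egf_even egf_even_nat; congr (_ - _).
  by field; rewrite gt_eqF.
have bd : geom_bounded d.
  apply: geom_boundedD => //; rewrite (_ : (fun m => _) =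
    (fun m => - (1 / (2 * s)) * (m%:R * even01 R m)))//.
  by apply/funext => m; rewrite mulNr.
have : a / 2 * expR s * (1 - 1 / s) <= bessel 0 s.
  apply: (@le_trans _ _ (egf (fun m => a * d m) s)); last first.
    apply: le_egf => //; first exact: geom_boundedZ.
    move=> m; apply: le_trans (return_ge m); rewrite le_eqVlt /d.
    apply/orP; left; apply/eqP; rewrite -natr1; field.
    by rewrite gt_eqF.
  rewrite egfZ// dE -!mulrA ler_wpM2l ?(ltW a_gt0)//.
  have : expR (- s) / s <= expR s / s.
    by rewrite ler_wpM2r ?invr_ge0//; have := emlt; have := eplt; lra.
  rewrite invfM /ch /sh; have := expR_ge0 (- s).
  by rewrite !mul1r; lra.
move=> /(ler_wpM2l norm_ge0); apply: le_trans.
by rewrite mulrA norm_a_exp [leRHS]mul1r.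
Qed.

Lemma bessel_asymptotic n :
  `|norm * bessel n s - 1| <= 4 * (1 + n%:R ^+ 2) / s.
Proof.
have s0 := ltW s_gt0; have n0 := sqr_ge0 (n%:R : R).
have up : norm * bessel n s <= 1 + 4 / s.
  apply: le_trans bessel0_le; rewrite ler_wpM2l//.
  exact: bessel_nonincr.
have i0 : 0 < s^-1 by rewrite invr_gt0.
have ns : 0 <= n%:R ^+ 2 / s by rewrite mulr_ge0// ltW.
have lo : 1 - (1 + n%:R ^+ 2) / s <= norm * bessel n s.
  have [ns1|ns1] := leP (n%:R ^+ 2 / s) 1.
    have := ler_wpM2l norm_ge0 (bessel_ge s_gt0 n); apply: le_trans; rewrite mulrA.
    apply: (@le_trans _ _ ((1 - 1 / s) * (1 - n%:R ^+ 2 / s))).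
      have := mulr_ge0 (ltW i0) ns; rewrite mul1r; lra.
    by rewrite ler_wpM2r ?subr_ge0//; exact: bessel0_ge.
  (* For n^2 > s the claimed lower bound is negative. *)
  apply: (@le_trans _ _ 0); first by lra.
  by rewrite mulr_ge0// ltW// bessel_gt0.
rewrite ler_norml; apply/andP; split; first by lra.
by lra.
Qed.

End BesselZero.

(** * The series for the heat kernel of the tree *)

Section TreeWalkFunction.
Variables (R : realType) (q : nat).
Set Implicit Arguments.
Unset Strict Implicit.
Hypothesis q_ge2 : (2 <= q)%N.
Implicit Types (s : R) (n k : nat).

Let qR : 2 <= q%:R :> R. Proof. by rewrite ler_nat. Qed.
Let q0 : 0 < q%:R :> R. Proof. by rewrite ltr0n; lia. Qed.
Let q1 : 0 < q%:R - 1 :> R. Proof. by have := qR; lra. Qed.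

(** By [tree_heatE], at [s = gamma0 R q * t] this is the tree heat kernel at distance n times e^t
    q^(n/2). *)
Definition tree_gf n s : R := egf (walk ((1 + q%:R^-1) / 2) ^~ n) s.

Let k01 : 0 <= (1 + (q%:R : R)^-1) / 2 <= 1.
Proof.
have : 0 <= (q%:R^-1 : R) <= 1 by rewrite invr_ge0 ler0n invf_le1// ler1n; lia.
by lra.
Qed.

Lemma tree_gf_itv n s : 0 <= s -> 0 <= tree_gf n s <= expR s.
Proof.
move=> s0; have bw : geom_bounded (@walk R ((1 + q%:R^-1) / 2) ^~ n).
  exact: walk_bounded.
apply/andP; split.
  rewrite -[leLHS](egf0 s); apply: le_egf => //.
    by apply: (@geom_bounded1 _ _ 0) => m; rewrite normr0.
  by move=> m; have /andP[] := walk_itv m n k01.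
rewrite -egf1; apply: le_egf => //.
  by apply: (@geom_bounded1 _ _ 1) => m; rewrite normr1.
by move=> m; have /andP[] := walk_itv m n k01.
Qed.

Lemma tree_gf_rec n s : s != 0 ->
  tree_gf n s = 2 / s * (n.+1%:R * bessel n.+1 s) + q%:R^-1 * tree_gf n.+2 s.
Proof.
move=> s0.
have bw i : geom_bounded (@walk R ((1 + q%:R^-1) / 2) ^~ i) by exact: walk_bounded.
have b1 i : geom_bounded (@walk R 1 ^~ i).
  by apply: walk_bounded; rewrite ler01 lexx.
have -> : 2 / s * (n.+1%:R * bessel n.+1 s) = bessel n s - bessel n.+2 s.
  apply: (mulfI s0); rewrite bessel_rec; field.
  by rewrite s0.
rewrite /bessel -egfB// /tree_gf -egfZ//.
apply/eqP; rewrite -subr_eq -egfB//; last exact: geom_boundedZ.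
apply/eqP; apply: eq_egf => m; apply: tree_walk_simple_walk.
by rewrite gt_eqF.
Qed.

Let step_le n k : (n + k.*2).+1%:R <= (2 * k%:R + 1) * n.+1%:R :> R.
Proof.
have -> : 2 * k%:R + 1 = (2 * k).+1%:R :> R by rewrite -[RHS]natr1 natrM.
rewrite -natrM ler_nat -mul2n.
nia.
Qed.

(** The linear factor is absorbed by a power of 3/2, which against q >= 2 still leaves a geometric
    decay, uniform in q. *)
Lemma lin_geom_le k : (2 * k%:R + 1) * q%:R ^- k <= 4 * (3 / 4) ^+ k :> R.
Proof.
have h : 2 * k%:R + 1 <= 4 * (3 / 2) ^+ k :> R.
  have : k%:R + 2 <= 2 * (3 / 2) ^+ k :> R.
    elim: k => [|k IH]; first by rewrite expr0; lra.
    rewrite exprS -[k.+1%:R]natr1; have : 0 <= k%:R :> R by []; move: IH; lra.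
  by lra.
have -> : 4 * (3 / 4) ^+ k = 4 * (3 / 2) ^+ k * 2^-1 ^+ k :> R.
  by rewrite -mulrA -exprMn; congr (_ * _ ^+ _); lra.
apply: ler_pM => //.
by rewrite -exprVn lerXn2r ?nnegrE ?invr_ge0// lef_pV2 ?posrE.
Qed.

Lemma lin_geom_cvg0 : 4 * (3 / 4) ^+ k @[k --> \oo] --> (0 : R).
Proof.
by apply: (@cvg_geometric R 4 (3 / 4)); rewrite ger0_norm; lra.
Qed.

(** Moving k times to n + 2k costs a factor q^-k, which beats linear growth. Solutions of the
    recursion can thus be compared through their inhomogeneous terms alone. *)
Lemma barrier (y : nat -> R) (K : R) : 0 <= K ->
  (forall n, y n <= q%:R^-1 * y n.+2) ->
  (forall n, y n <= K * n.+1%:R) -> forall n, y n <= 0.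
Proof.
move=> K0 yS yK n.
have step k : y n <= q%:R ^- k * y (n + k.*2)%N.
  elim: k => [|k IH]; first by rewrite expr0 invr1 mul1r addn0.
  apply: le_trans IH _; rewrite doubleS !addnS exprSr invfM -mulrA.
  by rewrite ler_wpM2l ?invr_ge0 ?exprn_ge0.
have bound k : y n <= K * n.+1%:R * (4 * (3 / 4) ^+ k).
  apply: le_trans (step k) _.
  apply: (@le_trans _ _ (K * n.+1%:R * ((2 * k%:R + 1) * q%:R ^- k))).
    rewrite mulrA [leRHS]mulrC ler_wpM2l ?invr_ge0 ?exprn_ge0//.
    apply: le_trans (yK _) _; rewrite -mulrA ler_wpM2l//.
    by rewrite [leRHS]mulrC step_le.
  by rewrite ler_wpM2l ?mulr_ge0// lin_geom_le.
have lim0 : K * n.+1%:R * (4 * (3 / 4) ^+ k) @[k --> \oo] --> (0 : R).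
  by rewrite -[X in _ --> X](mulr0 (K * n.+1%:R)); apply: cvgMl_tmp; exact: lin_geom_cvg0.
rewrite -(cvg_lim (@Rhausdorff R) lim0); apply: limr_ge.
  by apply/cvg_ex; exists 0.
by apply: nearW.
Qed.

(* The solution of [M n - M (n + 2) / q = n + 1] of linear growth, that is
   [\sum_k q^-k (n + 2 k + 1)]. *)
Definition weight n : R := q%:R / (q%:R - 1) * n.+1%:R + 2 * q%:R / (q%:R - 1) ^+ 2.

Lemma weight_rec n : weight n = n.+1%:R + q%:R^-1 * weight n.+2.
Proof.
rewrite /weight -[n.+3%:R]natr1 -[n.+2%:R]natr1; field.
by rewrite !gt_eqF.
Qed.

Lemma weight_ge n : n.+1%:R <= weight n.
Proof.
rewrite -[leLHS]addr0 lerD//; last by rewrite divr_ge0 ?sqr_ge0 ?mulr_ge0.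
by rewrite ler_peMl// ler_pdivlMr// mul1r; lra.
Qed.

Lemma weight_gt0 n : 0 < weight n.
Proof. by apply: lt_le_trans (weight_ge n); rewrite ltr0n. Qed.

Lemma weight_le n : weight n <= 6 * n.+1%:R.
Proof.
have n1 : 1 <= n.+1%:R :> R by rewrite ler1n.
have h1 : q%:R / (q%:R - 1) <= 2 :> R.
  by rewrite ler_pdivrMr//; have := qR; lra.
have h2 : 2 * q%:R / (q%:R - 1) ^+ 2 <= 4 :> R.
  rewrite ler_pdivrMr ?exprn_gt0//; have := qR => qq.
  have : 0 <= (q%:R - 2) * (4 * q%:R - 2) :> R by rewrite mulr_ge0//; lra.
  by lra.
have : q%:R / (q%:R - 1) * n.+1%:R <= 2 * n.+1%:R :> R by rewrite ler_wpM2r.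
by rewrite /weight; lra.
Qed.

(** As the Bessel functions decrease in the index, freezing the Bessel factor at its lowest index
    turns [weight] into a supersolution of [tree_gf_rec]. *)
Lemma tree_gf_le n s : 0 < s ->
  tree_gf n s <= 2 / s * bessel n.+1 s * weight n.
Proof.
move=> s0; have s0' := ltW s0; have sn0 : s != 0 by rewrite gt_eqF.
pose y i := tree_gf i s - 2 / s * bessel i.+1 s * weight i.
suff : y n <= 0 by rewrite subr_le0.
have c0 : 0 <= 2 / s by rewrite divr_ge0.
have B0 i : 0 <= bessel i s by rewrite ltW// bessel_gt0.
apply: (@barrier y (expR s)).
- exact: expR_ge0.
- move=> i; rewrite /y [tree_gf i s]tree_gf_rec// weight_rec.
  have : 2 / s * bessel i.+3 s * weight i.+2 <= 2 / s * bessel i.+1 s * weight i.+2.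
    rewrite ler_wpM2r ?(ltW (weight_gt0 _))// ler_wpM2l//.
    by apply: bessel_nonincr => //; rewrite !ltnS; lia.
  have qi : 0 <= q%:R^-1 :> R by rewrite invr_ge0.
  move=> /(ler_wpM2l qi).
  by lra.
- move=> i; apply: (@le_trans _ _ (expR s)).
    rewrite lerBlDr; have /andP[_ h] := tree_gf_itv i s0'.
    apply: le_trans h _; rewrite lerDl; apply: mulr_ge0.
      exact: mulr_ge0.
    exact/ltW/weight_gt0.
  by rewrite ler_peMr ?expR_ge0// ler1n.
Qed.

Lemma tree_gf_expand K n s : s != 0 ->
  tree_gf n s = 2 / s * \sum_(k < K)
    q%:R ^- k * ((n + k.*2).+1%:R * bessel (n + k.*2).+1 s) +
    q%:R ^- K * tree_gf (n + K.*2)%N s.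
Proof.
move=> s0; elim: K => [|K IH].
  by rewrite big_ord0 mulr0 add0r expr0 invr1 mul1r addn0.
rewrite IH big_ord_recr/= [tree_gf (n + K.*2) s]tree_gf_rec//.
by rewrite doubleS !addnS exprSr invfM; ring.
Qed.

Definition ratio_partial_sum K n s : R := \sum_(k < K) q%:R ^- k *
  ((n + k.*2).+1%:R / n.+1%:R * (bessel (n + k.*2).+1 s / bessel n.+1 s)).

(** This is the domination, uniform in n and s: the remainder after K terms is bounded by
    [tree_gf_le] at n + 2K, and [weight] there is at most 6 (2K+1) (n+1). *)
Lemma tree_gf_ratio K n s : 0 < s ->
  `|tree_gf n s / (2 / s * (n.+1%:R * bessel n.+1 s)) -
    ratio_partial_sum K n s| <= 6 * (4 * (3 / 4) ^+ K).
Proof.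
move=> s0; have sn0 : s != 0 by rewrite gt_eqF.
have B0 : 0 < bessel n.+1 s by exact: bessel_gt0.
have n0 : 0 < n.+1%:R :> R by rewrite ltr0n.
set d := 2 / s * (n.+1%:R * bessel n.+1 s).
have d0 : 0 < d by rewrite mulr_gt0 ?divr_gt0 ?mulr_gt0.
have -> : tree_gf n s / d - ratio_partial_sum K n s =
    q%:R ^- K * tree_gf (n + K.*2)%N s / d.
  rewrite [tree_gf n s](tree_gf_expand K)// mulrDl addrAC.
  rewrite -[RHS]add0r; congr (_ + _); apply/eqP; rewrite subr_eq0; apply/eqP.
  rewrite /ratio_partial_sum mulr_sumr mulr_suml; apply: eq_bigr => k _.
  rewrite /d; field.
  by rewrite nat1r sn0 pnatr_eq0 (gt_eqF B0) expf_neq0// gt_eqF.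
have /andP[g0 _] := tree_gf_itv (n + K.*2)%N (ltW s0).
rewrite ger0_norm; last by rewrite divr_ge0 ?(ltW d0)// mulr_ge0// invr_ge0 exprn_ge0.
apply: (@le_trans _ _ (6 * ((2 * K%:R + 1) * q%:R ^- K))); last first.
  by rewrite ler_wpM2l// lin_geom_le.
rewrite mulrA [leRHS]mulrC -mulrA ler_wpM2l ?invr_ge0 ?exprn_ge0//.
rewrite ler_pdivrMr//; apply: le_trans (tree_gf_le _ s0) _.
apply: (@le_trans _ _ (2 / s * bessel n.+1 s * weight (n + K.*2))).
  rewrite ler_wpM2r ?(ltW (weight_gt0 _))// ler_wpM2l ?divr_ge0 ?(ltW s0)//.
  by apply: bessel_nonincr => //; rewrite ltnS leq_addr.
have -> : 6 * (2 * K%:R + 1) * d =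
    2 / s * bessel n.+1 s * (6 * ((2 * K%:R + 1) * n.+1%:R)) by rewrite /d; ring.
rewrite ler_wpM2l//; first by rewrite mulr_ge0 ?(ltW B0)// divr_ge0// ltW.
by apply: le_trans (weight_le _) _; rewrite ler_wpM2l.
Qed.

Lemma tree_gf_asymptotic : exists2 K : R, 0 <= K & forall n s, 0 < s ->
  `|s / 2 * tree_gf n s * (Num.sqrt (2 * pi * s) * expR (- s)) - weight n| <=
  K * n.+1%:R ^+ 3 / s.
Proof.
exists (16 * 11 ^+ 3) => [|n s s0]; first by rewrite mulr_ge0// exprn_ge0.
 have s0' := ltW s0; have sn0 : s != 0 by rewrite gt_eqF.
set c := Num.sqrt (2 * pi * s) * expR (- s).
have c0 : 0 <= c by rewrite mulr_ge0 ?sqrtr_ge0// expR_ge0.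
pose e i := s / 2 * tree_gf i s * c - weight i.
(* A supersolution for the error [e]: 16 is twice the 8 of [err], which balances the cubic terms
   when q^-1 <= 1/2, and the shift 11 is large enough for the lower-order terms to survive the step
   from i to i + 2. *)
pose D i : R := 16 * (i%:R + 11) ^+ 3 / s.
have eE i : e i = i.+1%:R * (c * bessel i.+1 s - 1) + q%:R^-1 * e i.+2.
  by rewrite /e [tree_gf i s]tree_gf_rec// [weight i]weight_rec; field;
    rewrite sn0 gt_eqF.
have err i : `|i.+1%:R * (c * bessel i.+1 s - 1)| <= 8 * i.+1%:R ^+ 3 / s.
  rewrite normrM ger0_norm//.
  apply: le_trans (ler_wpM2l _ (bessel_asymptotic s0 i.+1)) _ => //.
  rewrite mulrA ler_wpM2r ?invr_ge0//.
  have : 1 <= i.+1%:R :> R by rewrite ler1n.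
  move: i.+1%:R => x x1; have : 0 <= (x - 1) * (x * (x + 1)) by rewrite !mulr_ge0//; lra.
  by lra.
have DE i : 8 * i.+1%:R ^+ 3 / s + q%:R^-1 * D i.+2 <= D i.
  apply: (@le_trans _ _ (8 * i.+1%:R ^+ 3 / s + 2^-1 * D i.+2)).
    rewrite lerD2l ler_wpM2r// ?lef_pV2 ?posrE//.
    by rewrite mulr_ge0 ?invr_ge0// mulr_ge0// exprn_ge0// addr_ge0.
  rewrite /D mulrA -mulrDl ler_wpM2r ?invr_ge0//.
  have e1 : i.+1%:R = i%:R + 1 :> R by rewrite natr1.
  rewrite -[i.+2%:R]natr1 e1.
  have : 0 <= i%:R :> R by [].
  move: i%:R => x x0.
  rewrite -subr_ge0 [X in 0 <= X](_ : _ =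
      8 * (24 * (x + 1) ^+ 2 + 168 * (x + 1) + 272)); last by field.
  by have := sqr_ge0 (x + 1); lra.
have qi : 0 <= q%:R^-1 :> R by rewrite invr_ge0.
have D0 i : 0 <= D i by rewrite mulr_ge0 ?invr_ge0// mulr_ge0// exprn_ge0// addr_ge0.
have up : forall i, e i - D i <= 0.
  apply: (@barrier _ (s / 2 * expR s * c)).
  - by rewrite !mulr_ge0 ?expR_ge0.
  - move=> i; rewrite eE mulrBr; have := DE i.
    by have := err i; rewrite ler_norml => /andP[]; lra.
  - move=> i; apply: (@le_trans _ _ (s / 2 * expR s * c)); last first.
      by rewrite ler_peMr ?ler1n// !mulr_ge0 ?expR_ge0.
    have /andP[_ h] := tree_gf_itv i s0'.
    have : s / 2 * tree_gf i s * c <= s / 2 * expR s * c.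
      by rewrite ler_wpM2r// ler_wpM2l// divr_ge0.
    have := D0 i; have := weight_gt0 i; rewrite /e; lra.
have lo : forall i, - e i - D i <= 0.
  apply: (@barrier _ 6) => //.
  - move=> i; rewrite eE mulrBr; have := DE i.
    by have := err i; rewrite ler_norml => /andP[]; lra.
  - move=> i; have /andP[h _] := tree_gf_itv i s0'.
    have : 0 <= s / 2 * tree_gf i s * c by rewrite !mulr_ge0.
    have := D0 i; have := weight_le i; rewrite /e; lra.
apply: (@le_trans _ _ (D n)).
  by rewrite ler_norml -/(e n); have := up n; have := lo n; lra.
rewrite ler_wpM2r ?invr_ge0//.
have n11 : n%:R + 11 <= 11 * n.+1%:R :> R.
  by rewrite -[n.+1%:R]natr1; have : 0 <= n%:R :> R by []; lra.
have h3 : (n%:R + 11) ^+ 3 <= 11 ^+ 3 * n.+1%:R ^+ 3 :> R.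
  by rewrite -exprMn lerXn2r// nnegrE ?mulr_ge0// addr_ge0.
by rewrite -[leRHS]mulrA ler_wpM2l.
Qed.

End TreeWalkFunction.

(** * Limits along a filter *)

Section Limits.
Variables (R : realType) (I : Type) (F : set_system I).
Set Implicit Arguments.
Unset Strict Implicit.
Context {FF : Filter F}.
Implicit Types (f g s : I -> R) (n : I -> nat).

Lemma cvg_near_eq f g (l : R) : (\forall i \near F, f i = g i) ->
  f i @[i --> F] --> l -> g i @[i --> F] --> l.
Proof.
move=> fg fl; apply: (squeeze_cvgr _ fl fl).
by apply: filterS fg => i ->; rewrite lexx.
Qed.

Lemma cvg_sum_ord K (f : nat -> I -> R) (l : nat -> R) :
  (forall k, f k i @[i --> F] --> l k) ->
  \sum_(k < K) f k i @[i --> F] --> \sum_(k < K) l k.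
Proof.
move=> fl; elim: K => [|K IH].
  rewrite big_ord0 (_ : (fun i => _) = (fun=> 0)); first exact: cvg_cst.
  by apply/funext => i; rewrite big_ord0.
rewrite big_ord_recr (_ : (fun i => _) =
  (fun i => \sum_(k < K) f k i + f K i)); first exact: cvgD.
by apply/funext => i; rewrite big_ord_recr.
Qed.

Variables (n : I -> nat) (s : I -> R).
Hypothesis s_oo : s i @[i --> F] --> +oo.

Lemma near_gt0 : \forall i \near F, 0 < s i.
Proof. exact: cvgry_gt. Qed.

Lemma inv_cvg0 : (s i)^-1 @[i --> F] --> (0 : R).
Proof. by apply/gtr0_cvgV0 => //; exact: near_gt0. Qed.

(** [rho n s] depends on n/s only, and a fixed shift of n changes n/s by o(1). *)
Lemma rho_cvg_finite (a : R) : (n i)%:R / s i @[i --> F] --> a ->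
  forall j, rho (n i + j) (s i) @[i --> F] --> Num.sqrt (a ^+ 2 + 1) - a.
Proof.
move=> na j.
have nja : (n i + j)%:R / s i @[i --> F] --> a.
  rewrite (_ : (fun i => _) = (fun i => (n i)%:R / s i + j%:R * (s i)^-1)); last first.
    by apply/funext => i; rewrite natrD mulrDl.
  rewrite -[X in _ --> X]addr0 -[X in _ --> a + X](mulr0 j%:R).
  by apply: cvgD => //; apply: cvgMl_tmp; exact: inv_cvg0.
apply: (@cvg_near_eq (fun i =>
    Num.sqrt (((n i + j)%:R / s i) ^+ 2 + 1) - (n i + j)%:R / s i)).
  apply: filterS near_gt0 => i s0; rewrite /rho mulrBl; congr (_ - _).
  have -> : ((n i + j)%:R / s i) ^+ 2 + 1 =
      ((n i + j)%:R ^+ 2 + s i ^+ 2) * (s i)^-1 ^+ 2.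
    by field; rewrite gt_eqF.
  by rewrite sqrtrM ?addr_ge0 ?sqr_ge0// sqrtr_sqr ger0_norm// invr_ge0 ltW.
apply: cvgB => //.
apply: (@cvg_comp _ _ _ (fun i => ((n i + j)%:R / s i) ^+ 2 + 1) Num.sqrt
  _ (nbhs (a ^+ 2 + 1))); last exact: sqrt_continuous.
apply: cvgD; last exact: cvg_cst.
by under eq_fun do rewrite expr2; rewrite expr2; exact: cvgM.
Qed.

Lemma rho_cvg_infinite : (n i)%:R / s i @[i --> F] --> +oo ->
  forall j, rho (n i + j) (s i) @[i --> F] --> (0 : R).
Proof.
move=> na j.
have inv0 : ((n i)%:R / s i)^-1 @[i --> F] --> (0 : R).
  by apply/gtr0_cvgV0 => //; exact: cvgry_gt.
apply: (squeeze_cvgr _ (cvg_cst 0) inv0).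
have n0 : \forall i \near F, 0 < (n i)%:R / s i by exact: cvgry_gt.
apply: filterS2 near_gt0 n0 => i s0 n0; rewrite (ltW (rho_gt0 s0 _))/=.
apply: le_trans (rho_nonincr s0 (leq_addr j (n i))) _.
have h0 := rho_gt0 s0 (n i).
rewrite -[leRHS]mul1r ler_pdivlMr//.
apply: le_trans (_ : rho (n i) (s i) * (rho (n i) (s i) + 2 * (n i)%:R / s i) <= _).
  by rewrite ler_wpM2l ?(ltW h0)// -mulrA; move: h0 n0; lra.
by rewrite rho_quadratic.
Qed.

Section RatioLimit.
Variable r : R.
Hypothesis rho_r : forall j, rho (n i + j) (s i) @[i --> F] --> r.

Lemma bratio_cvg j : bratio (s i) (n i + j) @[i --> F] --> r.
Proof.
apply: (squeeze_cvgr _ (rho_r j.+1) (rho_r j)).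
apply: filterS near_gt0 => i s0.
by rewrite addnS rho_le_bratio// bratio_le_rho.
Qed.

Lemma bessel_ratio_cvg j :
  bessel (n i + j).+1 (s i) / bessel (n i).+1 (s i) @[i --> F] --> r ^+ j.
Proof.
elim: j => [|j IH].
  apply: (@cvg_near_eq (fun=> 1)); last by rewrite expr0; exact: cvg_cst.
  by apply: filterS near_gt0 => i s0; rewrite addn0 divff// gt_eqF// bessel_gt0.
apply: (@cvg_near_eq (fun i => bratio (s i) (n i + j.+1) *
    (bessel (n i + j).+1 (s i) / bessel (n i).+1 (s i)))).
  apply: filterS near_gt0 => i s0; rewrite /bratio addnS.
  by rewrite mulrA divfK// gt_eqF// bessel_gt0.
by rewrite exprS; apply: cvgM; [exact: bratio_cvg|exact: IH].
Qed.

Hypothesis n_oo : n i @[i --> F] --> \oo.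

Lemma succ_ratio_cvg j : (n i + j).+1%:R / (n i).+1%:R @[i --> F] --> (1 : R).
Proof.
have inv0 : (n i).+1%:R^-1 @[i --> F] --> (0 : R).
  apply/gtr0_cvgV0; first by apply: nearW => i; rewrite ltr0n.
  apply/cvgrnyP; apply/cvgnyPge => A; move/cvgnyPge : n_oo => /(_ A).
  by apply: filterS => i /leqW.
rewrite (_ : (fun i => _) = (fun i => 1 + j%:R * (n i).+1%:R^-1)); last first.
  apply/funext => i; rewrite -addSn natrD mulrDl divff// pnatr_eq0//.
have : 1 + j%:R * (n i).+1%:R^-1 @[i --> F] --> (1 + j%:R * 0 : R).
  by apply: cvgD; [exact: cvg_cst|exact: cvgMl_tmp].
by rewrite mulr0 addr0.
Qed.

Variable q : nat.
Hypothesis q_ge2 : (2 <= q)%N.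
Hypothesis r_itv : 0 <= r <= 1.

Let z_itv : 0 <= r ^+ 2 / q%:R <= 2^-1.
Proof.
have [r0 r1] := andP r_itv.
rewrite divr_ge0 ?sqr_ge0//= -[leRHS]mul1r ler_pM ?sqr_ge0 ?invr_ge0//.
  by rewrite expr_le1.
by rewrite lef_pV2 ?posrE ?ltr0n// ?ler_nat//; lia.
Qed.

(** First K is chosen so that the geometric tail and the uniform remainder of [tree_gf_ratio] are
    small, then the finite sum converges at this fixed K: its k-th term tends to (r^2/q)^k. *)
Lemma tree_ratio_cvg :
  tree_gf q (n i) (s i) / (2 / s i * ((n i).+1%:R * bessel (n i).+1 (s i)))
    @[i --> F] --> (1 - r ^+ 2 / q%:R)^-1.
Proof.
have [z0 z1] := andP z_itv.
have psum K : ratio_partial_sum q K (n i) (s i) @[i --> F] -->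
    series (geometric 1 (r ^+ 2 / q%:R)) K.
  rewrite /series/= big_mkord /ratio_partial_sum.
  apply: (@cvg_sum_ord K (fun k i => q%:R ^- k * ((n i + k.*2).+1%:R / (n i).+1%:R *
    (bessel (n i + k.*2).+1 (s i) / bessel (n i).+1 (s i))))
    (fun k => 1 * (r ^+ 2 / q%:R) ^+ k)) => k.
  rewrite mul1r exprMn exprVn mulrC; apply: cvgMl_tmp.
  rewrite -exprM mul2n -[X in _ --> X]mul1r; apply: cvgM.
    exact: succ_ratio_cvg.
  exact: bessel_ratio_cvg.
have geo : series (geometric 1 (r ^+ 2 / q%:R)) K @[K --> \oo] -->
    (1 - r ^+ 2 / q%:R)^-1.
  rewrite -[X in _ --> X]mul1r; apply: cvg_geometric_series.
  by rewrite ger0_norm//; lra.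
have tail : 6 * (4 * (3 / 4) ^+ K) @[K --> \oo] --> (0 : R).
  by rewrite -[X in _ --> X](mulr0 6); apply: cvgMl_tmp; exact: lin_geom_cvg0.
apply/cvgrPdist_le => e e0; have e3 : 0 < e / 3 by rewrite divr_gt0.
have [K [gK tK]] : exists K, `|(1 - r ^+ 2 / q%:R)^-1 -
    series (geometric 1 (r ^+ 2 / q%:R)) K| <= e / 3 /\
    6 * (4 * (3 / 4) ^+ K) <= e / 3.
  move/cvgrPdist_le : geo => /(_ _ e3) g; move/cvgrPdist_le : tail => /(_ _ e3) t.
  have [K _ /(_ K (leqnn K)) [h1 h2]] := filterI g t.
  exists K; split => //; apply: le_trans h2.
  by rewrite sub0r normrN ler_norm.
move/cvgrPdist_le : (psum K) => /(_ _ e3) p.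
apply: filterS2 near_gt0 p => i s0 p.
have t := le_trans (tree_gf_ratio q_ge2 K (n i) s0) tK.
set Z := _ / (2 / s i * _) in t *.
rewrite (_ : _ - Z = ((1 - r ^+ 2 / q%:R)^-1 - series (geometric 1 (r ^+ 2 / q%:R)) K)
  + (series (geometric 1 (r ^+ 2 / q%:R)) K - ratio_partial_sum q K (n i) (s i))
  - (Z - ratio_partial_sum q K (n i) (s i))); last by lra.
apply: le_trans (ler_normB _ _) _.
have := ler_normD ((1 - r ^+ 2 / q%:R)^-1 - series (geometric 1 (r ^+ 2 / q%:R)) K)
  (series (geometric 1 (r ^+ 2 / q%:R)) K - ratio_partial_sum q K (n i) (s i)).
by lra.
Qed.

Lemma constant_series_limit :
  limn (fun m => \sum_(1 <= k < m) (q%:R ^- k * r ^+ (2 * k))) =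
  (1 - r ^+ 2 / q%:R)^-1 - 1 :> R.
Proof.
have [z0 z1] := andP z_itv.
apply/cvg_lim => //.
have geo : series (geometric 1 (r ^+ 2 / q%:R)) K @[K --> \oo] -->
    (1 - r ^+ 2 / q%:R)^-1.
  rewrite -[X in _ --> X]mul1r; apply: cvg_geometric_series.
  by rewrite ger0_norm//; lra.
have shifted : series (geometric 1 (r ^+ 2 / q%:R)) m - 1 @[m --> \oo] -->
    (1 - r ^+ 2 / q%:R)^-1 - 1 by apply: cvgB => //; exact: cvg_cst.
apply: cvg_trans shifted; apply: near_eq_cvg; near=> m.
rewrite /series/= big_ltn; last by near: m; exists 1%N.
rewrite expr0 mulr1 addrAC subrr add0r; apply: eq_bigr => k _.
by rewrite mul1r exprMn exprVn -exprM mulrC.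
Unshelve. all: by end_near. Qed.

End RatioLimit.
End Limits.

(** * The two asymptotic regimes *)

Section Assembly.
Variable R : realType.
Set Implicit Arguments.
Unset Strict Implicit.

Lemma powR_opp_half (a : R) n : 0 < a -> a `^ (- (n%:R / 2)) = Num.sqrt a ^- n.
Proof.
move=> a0; rewrite powRN; congr (_^-1).
by rewrite [n%:R / 2]mulrC powRrM powR12_sqrt ?(ltW a0)// powR_mulrn// sqrtr_ge0.
Qed.

Lemma powR_opp_3half (a : R) : 0 < a -> a `^ (- (3 / 2)) = (a * Num.sqrt a)^-1.
Proof.
move=> a0; rewrite powRN; congr (_^-1).
have -> : 3 / 2 = 1 + 2^-1 :> R by lra.
by rewrite powRD ?gt_eqF ?implybT// powRr1 ?(ltW a0)// powR12_sqrt// ltW.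
Qed.

Variables (q : nat) (q_ge2 : (2 <= q)%N).

Let q0 : (0 < q)%N. Proof. by lia. Qed.

Lemma tree_heat_ratio (T : choiceType) (adj : rel T) (o x : T) (C t : R) :
  homogeneous_tree q adj -> 0 < t ->
  let g0 := gamma0 R q in let n := gdist adj x o in let s := g0 * t in
  tree_heat q adj o t x /
    ((1 + C) * (2 / g0) * t^-1 * expR (- (1 - g0) * t) * (1 + n%:R) *
     q%:R `^ (- (n%:R / 2)) * int_heat (t * g0) (n%:Z + 1)) =
  tree_gf q n s / (2 / s * (n.+1%:R * bessel n.+1 s)) / (1 + C).
Proof.
move=> hT t0 g0 n s.
have /andP[gpos _] : 0 < g0 <= 1 by exact: gamma0_itv q0.
have s0 : 0 < s by rewrite mulr_gt0.
rewrite (@powR_opp_half q%:R n) ?ltr0n// (@tree_heatE R q T adj hT o q0 t x) -/n -/g0 -/s.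
have -> : (n%:Z + 1)%R = n.+1%:Z by rewrite intS addrC.
rewrite int_heatE [t * g0]mulrC -/s -/(bessel _ _) -/(tree_gf _ _ _).
have -> : expR (- t) = expR (- (1 - g0) * t) * expR (- s).
  by rewrite -expRD; congr expR; rewrite /s; ring.
have e1 := expR_gt0 (- (1 - g0) * t); have e2 := expR_gt0 (- s).
have B0 := bessel_gt0 n.+1 s0.
have r0 : 0 < Num.sqrt q%:R ^+ n :> R by rewrite exprn_gt0// sqrtr_gt0 ltr0n.
rewrite nat1r; have n0 : 0 < n.+1%:R :> R by rewrite ltr0n.
move: (expR (- (1 - g0) * t)) (expR (- s)) e1 e2 => E1 E2 e1 e2.
(* If [1 + C] vanishes, both sides are 0 because the inverse of 0 is 0. *)
have [->|C0] := eqVneq (1 + C) 0; first by rewrite !mul0r invr0 !mulr0.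
rewrite /s; field; rewrite C0 !gt_eqF//.
Qed.

Lemma tree_heat_main (T : choiceType) (adj : rel T) (o x : T) (t : R) :
  homogeneous_tree q adj -> 0 < t ->
  let g0 := gamma0 R q in let n := gdist adj x o in let s := g0 * t in
  tree_heat q adj o t x = Num.sqrt 2 / Num.sqrt pi
    * (q%:R * q.+1%:R / (q%:R - 1) ^+ 2)
    * g0 `^ (- (3 / 2)) * t `^ (- (3 / 2))
    * expR (- (1 - g0) * t) * phi0 R q n *
    (s / 2 * tree_gf q n s * (Num.sqrt (2 * pi * s) * expR (- s)) / weight R q n).
Proof.
move=> hT t0 g0 n s.
have /andP[gpos _] : 0 < g0 <= 1 by exact: gamma0_itv q0.
have s0 : 0 < s by rewrite mulr_gt0.
rewrite (@tree_heatE R q T adj hT o q0 t x) -/n -/g0 -/s -/(tree_gf _ _ _) /phi0.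
rewrite (@powR_opp_half q%:R n) ?ltr0n// !powR_opp_3half//.
have pi0 := pi_gt0 R.
have -> : Num.sqrt (2 * pi * s) = Num.sqrt 2 * Num.sqrt pi * (Num.sqrt g0 * Num.sqrt t).
  by rewrite /s !sqrtrM ?mulr_ge0 ?(ltW pi0) ?(ltW gpos).
have -> : expR (- t) = expR (- (1 - g0) * t) * expR (- s).
  by rewrite -expRD; congr expR; rewrite /s; ring.
(* The constant of part (2) and the linear factor of [phi0] are together [weight]. *)
have w0 : weight R q n = q%:R * q.+1%:R / (q%:R - 1) ^+ 2 *
    (1 + (q%:R - 1) / q.+1%:R * n%:R).
  have q1 : q%:R - 1 != 0 :> R by rewrite subr_eq0 pnatr_eq1; lia.
  rewrite /weight -[q.+1%:R]natr1 -[n.+1%:R]natr1; field.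
  by rewrite q1 natr1 pnatr_eq0.
have wpos := weight_gt0 R q_ge2 n.
rewrite w0 in wpos *.
set A := q%:R * q.+1%:R / _ in wpos *; set B := 1 + _ in wpos *.
have s2 : Num.sqrt 2 * Num.sqrt 2 = 2 :> R by rewrite -expr2 sqr_sqrtr.
have s2n : Num.sqrt 2 != 0 :> R by rewrite gt_eqF// sqrtr_gt0.
have spn : Num.sqrt pi != 0 :> R by rewrite gt_eqF// sqrtr_gt0.
have sgn : Num.sqrt g0 != 0 :> R by rewrite gt_eqF// sqrtr_gt0.
have stn : Num.sqrt t != 0 :> R by rewrite gt_eqF// sqrtr_gt0.
have r0 : Num.sqrt q%:R ^+ n != 0 :> R by rewrite gt_eqF// exprn_gt0// sqrtr_gt0 ltr0n.
have AB : A * B != 0 by rewrite gt_eqF.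
have [A0 B0] : A != 0 /\ B != 0 by move: AB; rewrite mulf_eq0 negb_or => /andP.
move: (expR (- (1 - g0) * t)) (expR (- s)) (tree_gf q n s) => E1 E2 G.
move: (Num.sqrt 2) (Num.sqrt pi) (Num.sqrt g0) (Num.sqrt t) (Num.sqrt q%:R ^+ n)
  s2 s2n spn sgn stn r0 => u2 up ug ut un s2 s2n spn sgn stn r0.
transitivity (u2 * u2 / 2 * (un^-1 * (E1 * E2 * G))).
  by rewrite s2 divff// mul1r.
rewrite /s; field.
by rewrite A0 B0 spn sgn stn r0 !gt_eqF.
Qed.

End Assembly.

Theorem theorem1 (R : realType) (q : nat) (hq : (2 <= q)%N)
    (T : choiceType) (adj : rel T) (hT : homogeneous_tree q adj) (o : T) :
  let h : R -> T -> R := tree_heat q adj o in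
  let g0 : R := gamma0 R q in
  let len (x : T) : nat := gdist adj x o in
  (forall (I : Type) (F : set_system I) (FF : Filter F) (x : I -> T) (t : I -> R),
      (len (x i) @[i --> F] --> \oo) ->
      (t i @[i --> F] --> +oo) ->
      let asymptotic (C : R) : Prop :=
        h (t i) (x i) /
          ((1 + C) * (2 / g0) * (t i)^-1 * expR (- (1 - g0) * t i)
           * (1 + (len (x i))%:R) * q%:R `^ (- ((len (x i))%:R / 2))
           * int_heat (t i * g0) ((len (x i))%:Z + 1))
        @[i --> F] --> (1 : R) in
      [/\ (forall C0 : R, 0 < C0 ->
            ((len (x i))%:R / t i @[i --> F] --> C0) ->
            let s0 : R := g0 / C0 in
            asymptotic (\big[+%R/0]_(1 <= k <oo)
              ((q%:R ^- k) * (s0 / (1 + Num.sqrt (1 + s0 ^+ 2))) ^+ (2 * k)))),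
          (((len (x i))%:R / t i @[i --> F] --> (0 : R)) ->
            asymptotic (1 / (q%:R - 1)))
        & (((len (x i))%:R / t i @[i --> F] --> +oo) ->
            asymptotic 0)])
  /\
  (forall rho : R -> R,
      (rho t / Num.sqrt t @[t --> +oo] --> (0 : R)) ->
      (exists2 c : R, 0 < c & \forall t \near +oo, c / Num.sqrt t <= rho t) ->
      exists M : R, \forall t \near +oo, forall x : T,
        (len x)%:R <= rho t ->
        exists2 e : R, `|e| <= M * (rho t / Num.sqrt t) &
          h t x = Num.sqrt 2 / Num.sqrt pi
                  * (q%:R * q.+1%:R / (q%:R - 1) ^+ 2)
                  * g0 `^ (- (3 / 2)) * t `^ (- (3 / 2))
                  * expR (- (1 - g0) * t) * phi0 R q (len x) * (1 + e)).
Proof.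
move=> h g0 len.
have q0 : (0 < q)%N by lia.
have /andP[gpos _] : 0 < g0 <= 1 := gamma0_itv R q0.
have qR : 2 <= q%:R :> R by rewrite ler_nat.
split.
- move=> I F FF x t x_oo t_oo asymptotic.
  have s_oo : g0 * t i @[i --> F] --> +oo.
    apply/cvgryPge => A; apply: filterS (cvgry_ge t_oo (A / g0)) => i.
    by rewrite ler_pdivrMr// mulrC.
  have lens i : (len (x i))%:R / (g0 * t i) = g0^-1 * ((len (x i))%:R / t i).
    by rewrite invfM mulrCA.
  (* The three regimes differ only in the limit [r] of the Bessel ratios; [1 + C] is the geometric
     series of ratio r^2/q. *)
  have key (r C : R) : 0 <= r <= 1 -> 1 + C = (1 - r ^+ 2 / q%:R)^-1 ->
      (forall j, rho (len (x i) + j) (g0 * t i) @[i --> F] --> r) -> asymptotic C.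
    move=> r01 CE rho_r.
    have [r0 r1] := andP r01.
    have C0 : 1 + C != 0.
      have : r ^+ 2 / q%:R <= 2^-1.
        rewrite -[leRHS]mul1r ler_pM ?sqr_ge0 ?invr_ge0//.
          by rewrite expr_le1.
        by rewrite lef_pV2 ?posrE ?ltr0n.
      by move=> zle; rewrite CE invr_eq0 gt_eqF//; lra.
    have Z := tree_ratio_cvg s_oo rho_r x_oo hq r01.
    rewrite -CE in Z.
    rewrite /asymptotic; apply: (cvg_near_eq (f := fun i =>
      tree_gf q (len (x i)) (g0 * t i) / (2 / (g0 * t i) *
        ((len (x i)).+1%:R * bessel (len (x i)).+1 (g0 * t i))) / (1 + C))).
      apply: filterS (cvgry_gt t_oo 0) => i ti.
      by rewrite -(tree_heat_ratio hq o (x i) C hT ti).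
    rewrite -[X in _ --> X](divff C0); by apply: cvgM; [exact: Z|exact: cvg_cst].
  split.
  + move=> C0 C0pos xt s0.
    have s0pos : 0 < s0 by rewrite divr_gt0.
    set w := Num.sqrt (1 + s0 ^+ 2).
    have w1 : 1 <= w.
      by rewrite -[leLHS]sqrtr1 ler_sqrt ?lerDl ?sqr_ge0// addr_ge0 ?sqr_ge0.
    have wE : w ^+ 2 = 1 + s0 ^+ 2 by rewrite sqr_sqrtr// addr_ge0 ?sqr_ge0.
    set r := s0 / (1 + w).
    have r01 : 0 <= r <= 1.
      rewrite divr_ge0 ?(ltW s0pos) ?addr_ge0 ?sqrtr_ge0//= ler_pdivrMr; last by lra.
      rewrite mul1r -(@ler_pXn2r _ 2) ?nnegrE ?(ltW s0pos)//; last by lra.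
      by rewrite sqrrD wE expr1n; move: w1; lra.
    apply: (key r) => //.
      by rewrite (constant_series_limit hq r01) addrC subrK.
    have na : (len (x i))%:R / (g0 * t i) @[i --> F] --> s0^-1.
      under eq_fun do rewrite lens.
      by rewrite /s0 invf_div [C0 / g0]mulrC; exact: cvgMl_tmp.
    (* The limit of n/s is 1/s0; rationalising the root of [rho_cvg_finite] gives the form in the
       statement. *)
    have -> : r = Num.sqrt (s0^-1 ^+ 2 + 1) - s0^-1.
      have -> : s0^-1 ^+ 2 + 1 = w ^+ 2 * s0^-1 ^+ 2.
        by rewrite wE; field; rewrite gt_eqF.
      rewrite -exprMn sqrtr_sqr ger0_norm; last first.
        by rewrite mulr_ge0 ?sqrtr_ge0// invr_ge0 ltW.
      have w0 : 1 + w != 0 by rewrite gt_eqF//; lra.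
      apply: (mulIf w0); rewrite /r divfK//.
      have -> : (w / s0 - s0^-1) * (1 + w) = (w ^+ 2 - 1) / s0 by ring.
      by rewrite wE addrAC subrr add0r expr2 mulfK// gt_eqF.
    exact: rho_cvg_finite.
  + move=> xt; apply: (key 1).
    * by rewrite ler01 lexx.
    * by rewrite expr1n; field; rewrite !gt_eqF//; lra.
    have na : (len (x i))%:R / (g0 * t i) @[i --> F] --> (0 : R).
      have h0 : g0^-1 * ((len (x i))%:R / t i) @[i --> F] --> (g0^-1 * 0 : R).
        exact: cvgMl_tmp.
      by rewrite mulr0 in h0; under eq_fun do rewrite lens.
    move=> j; have h1 := rho_cvg_finite s_oo na j.
    by rewrite expr0n/= add0r sqrtr1 subr0 in h1; exact: h1.
  + move=> xt; apply: (key 0).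
    * by rewrite lexx ler01.
    * by rewrite expr0n/= mul0r subr0 invr1 addr0.
    apply: rho_cvg_infinite => //.
    apply/cvgryPge => A; apply: filterS (cvgry_ge xt (A * g0)) => i h0.
    by rewrite lens mulrC ler_pdivlMr.
- move=> rho rho0 [c c0 rho_c].
  have [K K0 asym] := tree_gf_asymptotic R hq.
  (* Dividing by [weight], which is at least n+1, leaves the error K (n+1)^2/(g0 t), where (n+1)^2
     <= 2 n^2 + 2. With u = rho(t)/sqrt t <= 1, n^2/t is at most u^2 <= u, and 1/t is at most u/c by
     the lower bound on [rho]. *)
  exists (K / g0 * (2 + 2 / c)).
  have rho1 : \forall t \near +oo, rho t / Num.sqrt t <= 1.
    by have := cvgr_le _ rho0 1; apply.
  have t_gt0 : \forall t \near +oo, 0 < (t : R) by exact: nbhs_pinfty_gt.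
  near=> t.
  have t0 : 0 < t by near: t.
  have r1 : rho t / Num.sqrt t <= 1 by near: t.
  have rc : c / Num.sqrt t <= rho t by near: t.
  move=> x xr; set n := len x in xr *.
  have s0 : 0 < g0 * t by rewrite mulr_gt0.
  set X := g0 * t / 2 * tree_gf q n (g0 * t) *
    (Num.sqrt (2 * pi * (g0 * t)) * expR (- (g0 * t))) / weight R q n.
  have W0 := weight_gt0 R hq n.
  exists (X - 1); last first.
    by rewrite addrCA subrr addr0 /h (tree_heat_main hq o x hT t0).
  have n1 : 1 <= n.+1%:R :> R by rewrite ler1n.
  set u := rho t / Num.sqrt t in r1 *.
  have st0 : 0 < Num.sqrt t by rewrite sqrtr_gt0.
  have ct : c / t <= u.
    rewrite /u -[t in c / t](sqr_sqrtr (ltW t0)) expr2 invfM mulrA.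
    by rewrite ler_wpM2r ?invr_ge0 ?(ltW st0).
  have nt : n%:R ^+ 2 / t <= u.
    have u0 : 0 <= u by apply: le_trans ct; rewrite divr_ge0 ?ltW.
    have nu : n%:R / Num.sqrt t <= u by rewrite ler_wpM2r ?invr_ge0 ?(ltW st0).
    have n0 : 0 <= n%:R / Num.sqrt t by rewrite divr_ge0// ltW.
    rewrite -[t in _ / t](sqr_sqrtr (ltW t0)) -exprVn -exprMn expr2.
    by rewrite -[leRHS]mulr1 ler_pM// (le_trans nu).
  have XE : X - 1 = (g0 * t / 2 * tree_gf q n (g0 * t) *
      (Num.sqrt (2 * pi * (g0 * t)) * expR (- (g0 * t))) - weight R q n) / weight R q n.
    by rewrite mulrBl divff ?gt_eqF.
  rewrite XE normrM normfV (gtr0_norm W0) ler_pdivrMr//.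
  apply: le_trans (asym n _ s0) _.
  apply: (@le_trans _ _ (K / g0 * (n.+1%:R ^+ 2 / t) * n.+1%:R)).
    rewrite le_eqVlt; apply/orP; left; apply/eqP; rewrite exprS; field.
    by rewrite !gt_eqF.
  have Kg0 : 0 <= K / g0 by rewrite divr_ge0// ltW.
  apply: ler_pM => //.
  + by rewrite mulr_ge0// divr_ge0 ?exprn_ge0// ltW.
  + rewrite -!mulrA ler_wpM2l// ler_wpM2l ?invr_ge0 ?(ltW gpos)//.
    have tc : 2 / t <= 2 / c * u.
      have := ler_wpM2l (_ : 0 <= 2 / c) ct; rewrite divr_ge0 ?(ltW c0)// => /(_ isT).
      by rewrite mulrA divfK// gt_eqF.
    apply: (@le_trans _ _ (2 * (n%:R ^+ 2 / t) + 2 / t)); last by lra.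
    rewrite [leLHS]mulrA [X in _ <= X + _]mulrA -mulrDl ler_wpM2r ?invr_ge0 ?(ltW t0)//.
    by rewrite -[n.+1%:R]natr1; have := sqr_ge0 (n%:R - 1 : R); lra.
  + exact: weight_ge.
Unshelve. all: by end_near. Qed.
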